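(* Let $(\bar a,\bar\beta)$ be a stationary solution of the amplitude-phase system $$\frac{da}{dt}=\epsilon\left(-\frac{F_m\sin\beta}{2\omega}-\frac{\lambda a}{2}\right)+\epsilon^2\left(\frac{3d\lambda a^3}{16\omega^2}+\frac{\sigma F_m\sin\beta}{4\omega^2}+\frac{\lambda F_m\cos\beta}{8\omega^2}+\frac{9da^2F_m\sin\beta}{32\omega^3}\right)+O(\epsilon^3),$$ $$\frac{d\beta}{dt}=\epsilon\left(-\sigma+\frac{3da^2}{8\omega}-\frac{F_m\cos\beta}{2a\omega}\right)+\epsilon^2\left(-\frac{\lambda^2}{8\omega}-\frac{15d^2a^4}{256\omega^3}-\frac{5c^2a^2}{12\omega^3}+\frac{\sigma F_m\cos\beta}{4\omega^2a}+\frac{3daF_m\cos\beta}{32\omega^3}-\frac{\lambda F_m\sin\beta}{8\omega^2a}\right)+O(\epsilon^3).$$ When $$\sigma\le\frac{3d\bar a^2}{4\omega}-\frac12\sqrt{\frac{9d^2\bar a^4}{16\omega^2}-\lambda^2}$$ and $\epsilon$ is small enough, the stationary solution $(\bar a,\bar\beta)$ is stable in the sense of Lyapunov (if the dynamic solution of the system starts close to the stationary solution, it remains close to it and converges to it). To the stationary case corresponds the approximate solution $\tilde u_{app}=\epsilon u_{app}$ of $$\ddot{\tilde u}+\omega^2\tilde u+\epsilon\lambda\dot{\tilde u}+c\tilde u^2+\frac d\epsilon\tilde u^3=\epsilon^2F_m\cos(\tilde\omega_\epsilon t),\qquad \tilde\omega_\epsilon=\omega+\epsilon\sigma,$$ given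 by $$\tilde u_{app}=\epsilon\bar a\cos(\tilde\omega_\epsilon t+\bar\beta)+\epsilon^2\left[-\frac{c\bar a^2}{2\omega^2}+\frac{c\bar a^2}{6\omega^2}\cos(2(\tilde\omega_\epsilon t+\bar\beta))+\frac{d\bar a^3}{32\omega^2}\cos(3(\tilde\omega_\epsilon t+\bar\beta))\right],$$ and it is periodic up to the order two.
   Context: $\omega>0$, $\lambda>0$ (damping), $c,d,F_m,\sigma$ are real constants, and $\epsilon>0$ is a small parameter. The amplitude-phase system governs the slowly varying amplitude $a(t)$ and phase $\beta(t)$ in the approximate solution $\tilde u\approx\epsilon a\cos(\tilde\omega_\epsilon t+\beta)+\epsilon^2\left[-\frac{ca^2}{2\omega^2}+\frac{ca^2}{6\omega^2}\cos(2(\tilde\omega_\epsilon t+\beta))+\frac{da^3}{32\omega^2}\cos(3(\tilde\omega_\epsilon t+\beta))\right]$ of the forced equation. A stationary solution is a pair $(\bar a,\bar\beta)$ at which both right-hand sides vanish. The approximate solution corresponding to it is obtained by inserting $a=\bar a$, $\beta=\bar\beta$ in this approximation. $O(\epsilon^3)$ denotes remainder terms of third order in $\epsilon$. *)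

(* Defs.v *)
From Stdlib Require Import Reals.
From Coquelicot Require Import Coquelicot.
Open Scope R_scope.

(** ** The amplitude-phase system

    The phase space is [{(a, beta) | a <> 0}] since the system contains [1 / a].
    The boxes below exhaust it by compact sets. *)

Definition in_box (M a b : R) : Prop :=
  / M <= Rabs a <= M /\ Rabs b <= M.

(** [r eps a b] is an O(eps^3) remainder: on every compact box it is, for small
    [eps], of class C^1 in [(a, b)], and its value and its first partial
    derivatives are bounded by [C * eps^3] uniformly on the box.  A pointwise bound
    on the values alone would allow [eps^3 * sin (a / eps^3)], whose linearization
    dominates that of the whole system. *)
Definition third_order (r : R -> R -> R -> R) : Prop :=
  forall M : R, 0 < M ->
  exists C eps1 : R, 0 < eps1 /\
  forall eps a b : R, 0 < eps < eps1 -> in_box M a b ->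
    ex_derive (fun x => r eps x b) a /\
    ex_derive (fun y => r eps a y) b /\
    continuity_2d_pt (fun x y => Derive (fun z => r eps z y) x) a b /\
    continuity_2d_pt (fun x y => Derive (fun z => r eps x z) y) a b /\
    Rabs (r eps a b) <= C * eps ^ 3 /\
    Rabs (Derive (fun x => r eps x b) a) <= C * eps ^ 3 /\
    Rabs (Derive (fun y => r eps a y) b) <= C * eps ^ 3.

Definition amplitude_rhs (omega lambda d Fm sigma : R) (r : R -> R -> R -> R)
    (eps a beta : R) : R :=
  eps * (- (Fm * sin beta / (2 * omega)) - lambda * a / 2)
  + eps ^ 2 * (3 * d * lambda * a ^ 3 / (16 * omega ^ 2)
               + sigma * Fm * sin beta / (4 * omega ^ 2)
               + lambda * Fm * cos beta / (8 * omega ^ 2)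
               + 9 * d * a ^ 2 * Fm * sin beta / (32 * omega ^ 3))
  + r eps a beta.

Definition phase_rhs (omega lambda c d Fm sigma : R) (r : R -> R -> R -> R)
    (eps a beta : R) : R :=
  eps * (- sigma + 3 * d * a ^ 2 / (8 * omega)
         - Fm * cos beta / (2 * a * omega))
  + eps ^ 2 * (- (lambda ^ 2 / (8 * omega))
               - 15 * d ^ 2 * a ^ 4 / (256 * omega ^ 3)
               - 5 * c ^ 2 * a ^ 2 / (12 * omega ^ 3)
               + sigma * Fm * cos beta / (4 * omega ^ 2 * a)
               + 3 * d * a * Fm * cos beta / (32 * omega ^ 3)
               - lambda * Fm * sin beta / (8 * omega ^ 2 * a))
  + r eps a beta.

(** ** Planar autonomous systems [a' = f a b], [b' = g a b] on [{a <> 0}] *)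

Definition stationary (f g : R -> R -> R) (a0 b0 : R) : Prop :=
  a0 <> 0 /\ f a0 b0 = 0 /\ g a0 b0 = 0.

(** Solutions on [[0, T)], where [T] may be [p_infty]. *)
Definition solution (f g : R -> R -> R) (T : Rbar) (a b : R -> R) : Prop :=
  filterlim a (at_right 0) (locally (a 0)) /\
  filterlim b (at_right 0) (locally (b 0)) /\
  (forall t : R, 0 <= t -> Rbar_lt t T -> a t <> 0) /\
  (forall t : R, 0 < t -> Rbar_lt t T ->
     is_derive a t (f (a t) (b t)) /\ is_derive b t (g (a t) (b t))).

Definition close (delta a0 b0 a b : R) : Prop :=
  Rabs (a - a0) < delta /\ Rabs (b - b0) < delta.

Definition remains_close (f g : R -> R -> R) (a0 b0 : R) : Prop :=
  forall eta : R, 0 < eta ->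
  exists delta : R, 0 < delta /\
  forall (T : Rbar) (a b : R -> R),
    solution f g T a b -> close delta a0 b0 (a 0) (b 0) ->
    forall t : R, 0 <= t -> Rbar_lt t T -> close eta a0 b0 (a t) (b t).

Definition converges_to (f g : R -> R -> R) (a0 b0 : R) : Prop :=
  exists delta : R, 0 < delta /\
  forall a b : R -> R,
    solution f g p_infty a b -> close delta a0 b0 (a 0) (b 0) ->
    is_lim a p_infty a0 /\ is_lim b p_infty b0.

Definition lyapunov_stable (f g : R -> R -> R) (a0 b0 : R) : Prop :=
  remains_close f g a0 b0 /\ converges_to f g a0 b0.

(** ** The forced equation and its second order approximation *)

Definition forced_frequency (omega sigma eps : R) : R := omega + eps * sigma.

Definition approximation (omega c d sigma eps : R) (a beta : R -> R) (t : R) : R :=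
  let theta := forced_frequency omega sigma eps * t + beta t in
  eps * a t * cos theta
  + eps ^ 2 * (- (c * a t ^ 2 / (2 * omega ^ 2))
               + c * a t ^ 2 / (6 * omega ^ 2) * cos (2 * theta)
               + d * a t ^ 3 / (32 * omega ^ 2) * cos (3 * theta)).

(** [u] satisfies the forced equation with a residual at most [delta], for all times. *)
Definition solves_forced_up_to (omega lambda c d Fm sigma eps delta : R)
    (u : R -> R) : Prop :=
  forall t : R,
    ex_derive u t /\ ex_derive (Derive u) t /\
    Rabs (Derive (Derive u) t + omega ^ 2 * u t + eps * lambda * Derive u t
          + c * u t ^ 2 + d / eps * u t ^ 3
          - eps ^ 2 * Fm * cos (forced_frequency omega sigma eps * t)) <= delta.

Definition periodic (P : R) (u : R -> R) : Prop :=
  0 < P /\ forall t : R, u (t + P) = u t.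

(* Main.v *)
Require Import Defs.
From Stdlib Require Import Reals Lra Psatz.
From Coquelicot Require Import Coquelicot.
Open Scope R_scope.

(** Write [K = 3 d a^2 / (8 omega)].  At a stationary point the Jacobian divided by [eps] has
    trace [- lambda + O(eps)] and determinant [det0 + O(eps)], where
    [det0 = (sigma - K) (sigma - 3 K) + lambda^2 / 4], and the hypothesis on [sigma] says that
    [K] is on the side [det0 >= 0].  If [det0] dominates [eps], an explicit quadratic Lyapunov
    function gives asymptotic stability.

    The delicate case is [det0 = O(eps)], near a fold of the response curve, where the leading
    order does not decide the sign.  It does not occur for small [eps].  Indeed [det0] is the
    derivative of [response K = K (lambda^2 / 4 + (K - sigma)^2)], and eliminating the phase
    from the stationarity equations gives
    [E = response K + eps shift + O(eps^2)]
    with the constant [E = 3 d Fm^2 / (32 omega^3)].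
    If [0 <= det0 <= A eps], then [K] is within [O(sqrt eps)] of a critical point of [response],
    so [response K] is within [O(eps^(3/2))] of a critical value, while [shift] is positive and
    bounded away from [0].  Hence [E] differs from this fixed critical value, but only by
    [O(eps)], which is impossible for small [eps].

    In the residual of the approximate solution, the [eps^2] terms reduce to the leading order
    stationarity equations, which hold up to [O(eps)]. *)

(** * Lyapunov stability from the linearization *)

(** A solution is only continuous from the right at [0]. Freezing it at [f 0] for negative times
    gives two-sided continuity on all of [[0, T]], as the mean value theorem requires. *)
Lemma continuity_pt_extend_right (f : R -> R) (T : R) :
  filterlim f (at_right 0) (locally (f 0)) ->
  (forall t, 0 < t <= T -> continuity_pt f t) ->
  forall t, 0 <= t <= T -> continuity_pt (fun s => f (Rmax 0 s)) t.
Proof.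
intros H0 Hc t [[Ht|<-] HtT].
- apply continuity_pt_ext_loc with f; [|apply Hc; lra].
  exists (mkposreal t Ht); intros y Hy.
  apply Rabs_lt_between' in Hy; simpl in Hy; rewrite Rmax_right; lra.
- apply continuity_pt_locally; intros e.
  destruct (proj1 (filterlim_locally f (f 0)) H0 e) as [del Hdel].
  exists del; intros y Hy.
  rewrite (Rmax_left 0 0) by lra.
  destruct (Rle_lt_dec y 0) as [Hle|Hlt].
  + rewrite Rmax_left, Rminus_diag, Rabs_R0 by lra; apply cond_pos.
  + rewrite Rmax_right by lra; apply (Hdel y Hy Hlt).
Qed.

Lemma nonincreasing_of_derive (W dW : R -> R) (T : R) :
  0 <= T ->
  (forall t, 0 <= t <= T -> continuity_pt W t) ->
  (forall t, 0 < t < T -> is_derive W t (dW t)) ->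
  (forall t, 0 < t < T -> dW t <= 0) ->
  W T <= W 0.
Proof.
intros HT Hc Hd Hneg.
(* The intermediate point supplied by [MVT_gen] may be an endpoint, where [dW] has no known sign.
   [D] takes the value [0] there, so it is nonpositive everywhere. *)
pose (D := fun t => if Rlt_dec 0 t then if Rlt_dec t T then dW t else 0 else 0).
assert (HD : forall t, D t <= 0).
{ intros t; unfold D; destruct (Rlt_dec 0 t), (Rlt_dec t T); try lra; auto. }
destruct (MVT_gen W 0 T D) as [c [_ Hc2]].
- rewrite Rmin_left, Rmax_right by lra; intros t Ht; unfold D.
  destruct (Rlt_dec 0 t), (Rlt_dec t T); try lra; auto.
- rewrite Rmin_left, Rmax_right by lra; auto.
- specialize (HD c); nra.
Qed.

(** Induction along a real interval: let [m] be the supremum of the initial segments on which [P]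
    holds. The first hypothesis gives [P m], and the second extends [P] beyond [m], which is
    contradictory unless [T] is already passed. *)
Lemma continuation (P : R -> Prop) (T : R) :
  (forall t, 0 <= t <= T -> (forall s, 0 <= s < t -> P s) -> P t) ->
  (forall t, 0 <= t <= T -> P t ->
     exists del, 0 < del /\ forall s, t <= s < t + del -> P s) ->
  forall t, 0 <= t <= T -> P t.
Proof.
intros Hlim Hext t Ht.
pose (E := fun x => 0 <= x <= T /\ forall s, 0 <= s <= x -> P s).
destruct (completeness E) as [m [Hub Hlub]].
{ exists T; intros x [Hx _]; lra. }
{ exists 0; split; [lra|]; intros s Hs.
  apply Hlim; [lra|intros; lra]. }
assert (Hm0 : 0 <= m).
{ apply Hub; split; [lra|]; intros s Hs; apply Hlim; [lra|intros; lra]. }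
assert (HmT : m <= T) by (apply Hlub; intros x [Hx _]; lra).
assert (Hbelow : forall s, 0 <= s < m -> P s).
{ intros s Hs; destruct (Classical_Prop.classic (P s)) as [|Hn]; [assumption|].
  enough (m <= s) by lra.
  apply Hlub; intros x [Hx1 Hx2]; destruct (Rle_lt_dec x s); [assumption|].
  destruct Hn; apply Hx2; lra. }
assert (Hm : P m) by (apply Hlim; auto; lra).
destruct (Hext m (conj Hm0 HmT) Hm) as [del [Hdel Hs]].
destruct (Rlt_le_dec t (m + del)) as [Hlt|Hge].
- destruct (Rlt_le_dec t m); [apply Hbelow|apply Hs]; lra.
- enough (m + del / 2 <= m) by lra.
  apply Hub; split; [lra|]; intros s Hs'.
  destruct (Rlt_le_dec s m); [apply Hbelow|apply Hs]; lra.
Qed.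

(** While [W < v] the function [W] cannot increase, so it stays below [W 0 < v] and never leaves the
    region where the differential inequality is valid. Then [W t * exp (kappa * t)] is
    nonincreasing, as in Gronwall's argument. *)
Lemma trapped_decay (W dW : R -> R) (T v kappa : R) :
  0 <= kappa -> W 0 < v ->
  (forall t, 0 <= W t) ->
  (forall t, 0 <= t <= T -> continuity_pt W t) ->
  (forall t, 0 < t <= T -> is_derive W t (dW t)) ->
  (forall t, 0 < t <= T -> W t < v -> dW t <= - kappa * W t) ->
  forall t, 0 <= t <= T -> W t < v /\ W t * exp (kappa * t) <= W 0.
Proof.
intros Hk H0 Hpos Hc Hd Hdec.
assert (Htrap : forall t, 0 <= t <= T -> W t < v).
{ apply continuation.
  - intros t Ht Hs.
    apply Rle_lt_trans with (W 0); [|assumption].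
    apply nonincreasing_of_derive with dW; try lra.
    + intros; apply Hc; lra.
    + intros; apply Hd; lra.
    + intros s Hs'; specialize (Hdec s ltac:(lra) (Hs s ltac:(lra))).
      specialize (Hpos s); nra.
  - intros t Ht Hv.
    assert (He : 0 < v - W t) by lra.
    destruct (proj1 (continuity_pt_locally W t) (Hc t Ht) (mkposreal _ He))
      as [del Hdel].
    exists del; split; [apply cond_pos|]; intros s Hs.
    assert (Hb : ball t del s) by (apply Rabs_lt_between'; lra).
    apply Hdel, Rabs_lt_between' in Hb; simpl in Hb; lra. }
intros t Ht; split; [auto|].
replace (W 0) with (W 0 * exp (kappa * 0)) by (rewrite Rmult_0_r, exp_0; ring).
apply (nonincreasing_of_derive (fun s => W s * exp (kappa * s))
         (fun s => (dW s + kappa * W s) * exp (kappa * s))); try lra.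
- intros s Hs; apply continuity_pt_mult; [apply Hc; lra|].
  apply continuity_pt_filterlim, (ex_derive_continuous (fun s => exp (kappa * s))).
  auto_derive; auto.
- intros s Hs.
  evar_last; [apply (is_derive_mult (K := R_AbsRing) W (fun s => exp (kappa * s)) s (dW s) (kappa * exp (kappa * s)))|].
  + apply Hd; lra.
  + auto_derive; auto; ring.
  + intros; apply Rmult_comm.
  + unfold plus, mult; simpl; ring.
- intros s Hs.
  specialize (Hdec s ltac:(lra) (Htrap s ltac:(lra))).
  pose proof (exp_pos (kappa * s)); nra.
Qed.

Lemma linear_stability (f g : R -> R -> R) (a0 b0 p q u w : R) :
  f a0 b0 = 0 -> g a0 b0 = 0 ->
  differentiable_pt_lim f a0 b0 p q ->
  differentiable_pt_lim g a0 b0 u w ->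
  p + w < 0 -> 0 < p * w - q * u ->
  lyapunov_stable f g a0 b0.
Proof.
intros Hf0 Hg0 Hf Hg Htr Hdet.
set (D := p * w - q * u) in *.
(* With [A] the Jacobian, [V z = D |z|^2 + |adj A z|^2] has derivative [2 D (tr A) |z|^2]
   along the linear flow, by [adj A * A = D I] and [adj A + A = (tr A) I]. *)
set (al := D + w ^ 2 + u ^ 2); set (be := - (w * q + p * u));
set (ga := D + q ^ 2 + p ^ 2).
set (L := al + 2 * Rabs be + ga).
set (V := fun x y => al * x ^ 2 + 2 * be * x * y + ga * y ^ 2).
assert (HVlow : forall x y, D * (x ^ 2 + y ^ 2) <= V x y).
{ intros x y.
  replace (V x y) with (D * (x ^ 2 + y ^ 2) + (w * x - q * y) ^ 2 + (p * y - u * x) ^ 2)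
    by (unfold V, al, be, ga; ring).
  pose proof (pow2_ge_0 (w * x - q * y)); pose proof (pow2_ge_0 (p * y - u * x)); lra. }
assert (Hal : D <= al) by (unfold al; nra).
assert (Hga : D <= ga) by (unfold ga; nra).
assert (HL : 2 * D <= L) by (unfold L; pose proof (Rabs_pos be); lra).
assert (HVup : forall x y m, Rabs x <= m -> Rabs y <= m -> V x y <= L * m ^ 2).
{ intros x y m Hx Hy; unfold V, L.
  pose proof (Rabs_pos x); pose proof (Rabs_pos y).
  assert (x ^ 2 <= m ^ 2) by (rewrite <- (pow2_abs x); apply pow_incr; lra).
  assert (y ^ 2 <= m ^ 2) by (rewrite <- (pow2_abs y); apply pow_incr; lra).
  assert (be * x * y <= Rabs be * m ^ 2).
  { apply Rle_trans with (1 := Rle_abs _); rewrite !Rabs_mult, Rmult_assoc.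
    apply Rmult_le_compat_l; [apply Rabs_pos|nra]. }
  nra. }
(* With this tolerance on the linearization error, the error contributes at most [2 * L * eta * m ^
   2 = - D * (p + w) * m ^ 2], half of the decay produced by the linear part. *)
set (eta := - D * (p + w) / (2 * L)).
assert (Heta : 0 < eta).
{ unfold eta; apply Rdiv_lt_0_compat; nra. }
destruct (Hf (mkposreal _ Heta)) as [d1 Hd1].
destruct (Hg (mkposreal _ Heta)) as [d2 Hd2].
(* The remaining half of the decay, compared with [V <= L * m ^ 2], gives this exponential rate. *)
set (kappa := - D * (p + w) / L).
assert (Hkappa : 0 < kappa).
{ unfold kappa; apply Rdiv_lt_0_compat; nra. }
set (r0 := Rmin d1 d2).
assert (Hr0 : 0 < r0) by (apply Rmin_pos; apply cond_pos).
set (Vdot := fun a b => (2 * al * (a - a0) + 2 * be * (b - b0)) * f a b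
                      + (2 * be * (a - a0) + 2 * ga * (b - b0)) * g a b).
assert (Hdot : forall a b, Rabs (a - a0) < r0 -> Rabs (b - b0) < r0 ->
  Vdot a b <= - kappa * V (a - a0) (b - b0)).
{ intros a b Ha Hb.
  specialize (Hd1 a b (Rlt_le_trans _ _ _ Ha (Rmin_l _ _)) (Rlt_le_trans _ _ _ Hb (Rmin_l _ _))).
  specialize (Hd2 a b (Rlt_le_trans _ _ _ Ha (Rmin_r _ _)) (Rlt_le_trans _ _ _ Hb (Rmin_r _ _))).
  simpl in Hd1, Hd2; rewrite Hf0 in Hd1; rewrite Hg0 in Hd2.
  unfold Vdot.
  set (x := a - a0) in *; set (y := b - b0) in *; set (m := Rmax (Rabs x) (Rabs y)) in *.
  set (e1 := f a b - 0 - (p * x + q * y)) in Hd1.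
  set (e2 := g a b - 0 - (u * x + w * y)) in Hd2.
  replace (f a b) with (p * x + q * y + e1) by (unfold e1; ring).
  replace (g a b) with (u * x + w * y + e2) by (unfold e2; ring).
  assert (Hxm : Rabs x <= m) by apply Rmax_l.
  assert (Hym : Rabs y <= m) by apply Rmax_r.
  assert (Hm : m ^ 2 <= x ^ 2 + y ^ 2).
  { unfold m, Rmax; destruct (Rle_dec (Rabs x) (Rabs y)); rewrite pow2_abs; nra. }
  pose proof (HVup x y m Hxm Hym) as HV.
  pose proof (Rabs_pos x); pose proof (Rabs_pos y).
  assert (E1 : forall k z e, Rabs z <= m -> Rabs e <= eta * m ->
    k * z * e <= Rabs k * (eta * m ^ 2)).
  { intros k z e Hz He; apply Rle_trans with (1 := Rle_abs _).
    rewrite !Rabs_mult, Rmult_assoc; apply Rmult_le_compat_l; [apply Rabs_pos|].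
    replace (eta * m ^ 2) with (m * (eta * m)) by ring.
    apply Rmult_le_compat; auto using Rabs_pos. }
  pose proof (E1 al x e1 Hxm Hd1) as F1; pose proof (E1 be y e1 Hym Hd1) as F2.
  pose proof (E1 be x e2 Hxm Hd2) as F3; pose proof (E1 ga y e2 Hym Hd2) as F4.
  rewrite (Rabs_pos_eq al) in F1 by lra; rewrite (Rabs_pos_eq ga) in F4 by lra.
  assert (Hmain : (2 * al * x + 2 * be * y) * (p * x + q * y + e1)
     + (2 * be * x + 2 * ga * y) * (u * x + w * y + e2)
     <= 2 * D * (p + w) * (x ^ 2 + y ^ 2) + 2 * L * eta * m ^ 2).
  { replace (2 * L * eta * m ^ 2) with
      (2 * (al * (eta * m ^ 2) + Rabs be * (eta * m ^ 2) + Rabs be * (eta * m ^ 2) + ga * (eta * m ^ 2)))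
      by (unfold L; ring).
    replace (2 * D * (p + w) * (x ^ 2 + y ^ 2)) with
      ((2 * al * x + 2 * be * y) * (p * x + q * y) + (2 * be * x + 2 * ga * y) * (u * x + w * y))
      by (unfold al, be, ga, D; ring).
    nra. }
  apply Rle_trans with (1 := Hmain).
  replace (2 * L * eta) with (- D * (p + w)) by (unfold eta; field; lra).
  assert (Hkm : kappa * V x y <= - D * (p + w) * m ^ 2).
  { replace (- D * (p + w) * m ^ 2) with (kappa * (L * m ^ 2)) by (unfold kappa; field; lra).
    apply Rmult_le_compat_l; lra. }
  assert (0 < - D * (p + w)) by nra.
  nra. }
assert (Hin : forall r a b, 0 < r -> V (a - a0) (b - b0) < D * r ^ 2 ->
  Defs.close r a0 b0 a b).
{ intros r a b Hr HVr; specialize (HVlow (a - a0) (b - b0)).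
  assert ((a - a0) ^ 2 + (b - b0) ^ 2 < r ^ 2) by (apply Rmult_lt_reg_l with D; lra).
  assert (Habs : forall z, z ^ 2 < r ^ 2 -> Rabs z < r).
  { intros z Hz; rewrite <- pow2_abs in Hz; pose proof (Rabs_pos z); nra. }
  pose proof (pow2_ge_0 (a - a0)); pose proof (pow2_ge_0 (b - b0)).
  split; apply Habs; lra. }
assert (Hdecay : forall (T : Rbar) (a b : R -> R) r, 0 < r <= r0 -> solution f g T a b ->
  V (a 0 - a0) (b 0 - b0) < D * r ^ 2 ->
  forall t, 0 <= t -> Rbar_lt t T ->
    V (a t - a0) (b t - b0) < D * r ^ 2 /\
    V (a t - a0) (b t - b0) * exp (kappa * t) <= V (a 0 - a0) (b 0 - b0)).
{ intros T a b r Hr (Ha0 & Hb0 & _ & Hder) Hstart t Ht HtT.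
  assert (Hlt : forall s, s <= t -> Rbar_lt s T)
    by (intros s Hs; apply Rbar_le_lt_trans with (2 := HtT); exact Hs).
  set (W := fun s => V (a (Rmax 0 s) - a0) (b (Rmax 0 s) - b0)).
  assert (Hcont : forall h, (forall s, 0 < s <= t -> ex_derive h s) ->
     forall s, 0 < s <= t -> continuity_pt h s).
  { intros h Hh s Hs; apply continuity_pt_filterlim, (ex_derive_continuous h), Hh, Hs. }
  pose proof (trapped_decay W (fun s => Vdot (a s) (b s)) t (D * r ^ 2) kappa) as HW.
  replace (a t) with (a (Rmax 0 t)) by (rewrite Rmax_right; auto).
  replace (b t) with (b (Rmax 0 t)) by (rewrite Rmax_right; auto).
  replace (a 0) with (a (Rmax 0 0)) by (rewrite Rmax_right; auto; lra).
  replace (b 0) with (b (Rmax 0 0)) by (rewrite Rmax_right; auto; lra).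
  apply HW; try lra.
  - unfold W; rewrite Rmax_right; lra.
  - intros s; unfold W; apply Rle_trans with (2 := HVlow _ _).
    apply Rmult_le_pos; [lra|apply Rplus_le_le_0_compat; apply pow2_ge_0].
  - intros s Hs; unfold W, V, pow.
    assert (Ca := continuity_pt_extend_right a t Ha0
      (Hcont a (fun s Hs => ex_intro _ _ (proj1 (Hder s (proj1 Hs) (Hlt s (proj2 Hs)))))) s Hs).
    assert (Cb := continuity_pt_extend_right b t Hb0
      (Hcont b (fun s Hs => ex_intro _ _ (proj2 (Hder s (proj1 Hs) (Hlt s (proj2 Hs)))))) s Hs).
    assert (Cc : forall k, continuity_pt (fun _ => k) s)
      by (intros; apply continuity_pt_const; now intros ? ?).
    apply (fun h => continuity_pt_minus _ _ s h (Cc a0)) in Ca.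
    apply (fun h => continuity_pt_minus _ _ s h (Cc b0)) in Cb.
    repeat first [exact Ca | exact Cb | apply Cc
                 | apply continuity_pt_plus | apply continuity_pt_mult].
  - intros s Hs; unfold W.
    apply is_derive_ext_loc with (fun s => V (a s - a0) (b s - b0)).
    { exists (mkposreal s (proj1 Hs)); intros y Hy.
      apply Rabs_lt_between' in Hy; simpl in Hy; rewrite Rmax_right; auto; lra. }
    destruct (Hder s (proj1 Hs) (Hlt s (proj2 Hs))) as [Da Db].
    unfold V, Vdot; auto_derive.
    + repeat split; try (eexists; eassumption).
    + change (Derive (fun x => a x) s) with (Derive a s).
      change (Derive (fun x => b x) s) with (Derive b s).
      rewrite (is_derive_unique _ _ _ Da), (is_derive_unique _ _ _ Db); ring.
  - intros s Hs; unfold W; rewrite Rmax_right by lra; intros HWs.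
    apply Hin in HWs; [|lra]; destruct HWs; apply Hdot; lra. }
(* On the square of half-side [r * shrink] the bound [V <= L * m ^ 2] gives
   [V <= D * shrink * r ^ 2], which is below the level [D * r ^ 2] because [2 * D <= L]. *)
set (shrink := D / L).
assert (Hshrink : 0 < shrink) by (apply Rdiv_lt_0_compat; lra).
assert (Hstart : forall r a b, 0 < r -> Defs.close (r * shrink) a0 b0 a b ->
  V (a - a0) (b - b0) < D * r ^ 2).
{ intros r a b Hr [Ha Hb].
  apply Rle_lt_trans with (1 := HVup _ _ (r * shrink) (Rlt_le _ _ Ha) (Rlt_le _ _ Hb)).
  replace (L * (r * shrink) ^ 2) with (D * shrink * r ^ 2) by (unfold shrink; field; lra).
  assert (shrink < 1) by (apply Rlt_div_l; lra).
  assert (0 < D * r ^ 2) by (apply Rmult_lt_0_compat; [|apply pow_lt]; lra).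
  nra. }
split.
- intros e He.
  set (r := Rmin e r0).
  assert (Hr : 0 < r) by (apply Rmin_pos; lra).
  exists (r * shrink); split; [nra|].
  intros T a b Hsol Hclose t Ht HtT.
  destruct (Hdecay T a b r (conj Hr (Rmin_r _ _)) Hsol (Hstart _ _ _ Hr Hclose) t Ht HtT) as [Ht1 _].
  apply Hin in Ht1; [|assumption]; pose proof (Rmin_l e r0 : r <= e).
  destruct Ht1; split; lra.
- exists (r0 * shrink); split; [nra|].
  intros a b Hsol Hclose.
  assert (Hev : forall e, 0 < e -> exists t0, forall t, t0 < t -> Defs.close e a0 b0 (a t) (b t)).
  { intros e He; set (V0 := V (a 0 - a0) (b 0 - b0)).
    assert (HDe : 0 < D * e ^ 2) by (apply Rmult_lt_0_compat; [|apply pow_lt]; lra).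
    (* Bounding [exp (kappa * t)] below by [1 + kappa * t] gives an explicit waiting time without
       logarithms. *)
    exists (Rmax 0 (V0 / (kappa * (D * e ^ 2)))); intros t Ht.
    assert (Ht0 := Rle_lt_trans _ _ _ (Rmax_l _ _) Ht).
    assert (Ht1 := Rle_lt_trans _ _ _ (Rmax_r _ _) Ht).
    apply Rlt_div_l in Ht1; [|nra].
    destruct (Hdecay p_infty a b r0 (conj Hr0 (Rle_refl _)) Hsol (Hstart _ _ _ Hr0 Hclose)
      t (Rlt_le _ _ Ht0) I) as [_ HVt].
    apply Hin; [assumption|].
    apply Rnot_le_lt; intros Hge.
    assert (Hexp : 1 + kappa * t <= exp (kappa * t)) by apply exp_ineq1_le.
    fold V0 in HVt.
    assert (D * e ^ 2 * (1 + kappa * t) <= V (a t - a0) (b t - b0) * exp (kappa * t))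
      by (apply Rmult_le_compat; nra).
    nra. }
  split; apply is_lim_spec; intros e; destruct (Hev e (cond_pos e)) as [t0 Ht0];
    exists t0; intros t Ht; apply Ht0, Ht.
Qed.

(** * Estimates uniform in the stationary point *)

Lemma at_right_pos : at_right 0 (fun eps => 0 < eps).
Proof. exists (mkposreal 1 Rlt_0_1); auto. Qed.

Lemma at_right_lt (b : R) : 0 < b -> at_right 0 (fun eps => eps < b).
Proof.
intros Hb; exists (mkposreal b Hb); intros y Hy _.
apply Rabs_lt_between' in Hy; simpl in Hy; lra.
Qed.

Lemma at_right_interval (P : R -> Prop) :
  at_right 0 P <-> exists e, 0 < e /\ forall eps, 0 < eps < e -> P eps.
Proof.
split.
- intros [e He]; exists e; split; [apply cond_pos|]; intros eps Heps.
  apply He; [apply Rabs_lt_between'|]; lra.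
- intros [e [He HP]].
  generalize (filter_and _ _ at_right_pos (at_right_lt e He)).
  apply filter_imp; auto.
Qed.

Lemma at_right_linear (a b : R) : 0 < b -> at_right 0 (fun eps => a * eps < b).
Proof.
intros Hb; pose proof (Rabs_pos a).
assert (Hd : 0 < b / (Rabs a + 1)) by (apply Rdiv_lt_0_compat; lra).
generalize (filter_and _ _ at_right_pos (at_right_lt _ Hd)).
apply filter_imp; intros eps [Hpos Hlt].
apply Rlt_div_r in Hlt; [|lra].
pose proof (Rle_abs a); nra.
Qed.

(** The constant and the range of [eps] are chosen before [x], so the bound is uniform. The set
    [P eps] of admissible points may move with [eps], as the stationary points do. *)
Definition bigO {X : Type} (P : R -> X -> Prop) (n : nat) (h : R -> X -> R) : Prop :=
  exists C, 0 <= C /\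
    at_right 0 (fun eps => forall x, P eps x -> Rabs (h eps x) <= C * eps ^ n).

Section BigO.
Context {X : Type} (P : R -> X -> Prop).
Implicit Types (h k : R -> X -> R) (n m : nat).

Lemma bigO_ext n h k :
  (forall eps x, 0 < eps -> P eps x -> h eps x = k eps x) ->
  bigO P n h -> bigO P n k.
Proof.
intros E [C [HC H]]; exists C; split; [assumption|].
generalize (filter_and _ _ at_right_pos H); apply filter_imp.
intros eps [Heps Hx] x Px; rewrite <- E; auto.
Qed.

Lemma bigO_const c : bigO P 0 (fun _ _ => c).
Proof.
exists (Rabs c); split; [apply Rabs_pos|].
apply filter_forall; intros; simpl; lra.
Qed.

Lemma bigO_eps n : bigO P n (fun eps _ => eps ^ n).
Proof.
exists 1; split; [lra|].
generalize at_right_pos; apply filter_imp; intros eps He x _.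
rewrite Rabs_pos_eq; [lra|apply pow_le; lra].
Qed.

Lemma bigO_opp n h : bigO P n h -> bigO P n (fun eps x => - h eps x).
Proof.
intros [C [HC H]]; exists C; split; [assumption|].
revert H; apply filter_imp; intros eps H x Px; rewrite Rabs_Ropp; auto.
Qed.

Lemma bigO_plus n h k :
  bigO P n h -> bigO P n k -> bigO P n (fun eps x => h eps x + k eps x).
Proof.
intros [C [HC H]] [D [HD K]]; exists (C + D); split; [lra|].
generalize (filter_and _ _ H K); apply filter_imp; intros eps [H' K'] x Px.
apply Rle_trans with (1 := Rabs_triang _ _).
specialize (H' x Px); specialize (K' x Px); lra.
Qed.

Lemma bigO_minus n h k :
  bigO P n h -> bigO P n k -> bigO P n (fun eps x => h eps x - k eps x).
Proof. intros H K; apply bigO_plus; [|apply bigO_opp]; assumption. Qed.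

Lemma bigO_mult n m h k :
  bigO P n h -> bigO P m k -> bigO P (n + m) (fun eps x => h eps x * k eps x).
Proof.
intros [C [HC H]] [D [HD K]]; exists (C * D); split; [nra|].
generalize (filter_and _ _ H K); apply filter_imp; intros eps [H' K'] x Px.
rewrite Rabs_mult, pow_add.
replace (C * D * (eps ^ n * eps ^ m)) with ((C * eps ^ n) * (D * eps ^ m)) by ring.
apply Rmult_le_compat; auto using Rabs_pos.
Qed.

Lemma bigO_mult0l n h k :
  bigO P 0 h -> bigO P n k -> bigO P n (fun eps x => h eps x * k eps x).
Proof. apply (bigO_mult 0). Qed.

Lemma bigO_mult0r n h k :
  bigO P n h -> bigO P 0 k -> bigO P n (fun eps x => h eps x * k eps x).
Proof. rewrite (plus_n_O n) at 2; apply bigO_mult. Qed.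

Lemma bigO_pow0 h m : bigO P 0 h -> bigO P 0 (fun eps x => h eps x ^ m).
Proof.
intros H; induction m as [|m IH]; simpl.
- apply bigO_const.
- apply (bigO_mult0l 0); assumption.
Qed.

Lemma bigO_div_eps n h : bigO P (S n) h -> bigO P n (fun eps x => h eps x / eps).
Proof.
intros [C [HC H]]; exists C; split; [assumption|].
generalize (filter_and _ _ at_right_pos H); apply filter_imp.
intros eps [He H'] x Px; unfold Rdiv; rewrite Rabs_mult.
rewrite (Rabs_pos_eq (/ eps)) by (left; apply Rinv_0_lt_compat; lra).
apply Rle_div_l; [lra|]; specialize (H' x Px); simpl in H'; nra.
Qed.

Lemma bigO_weaken n h : bigO P (S n) h -> bigO P n h.
Proof.
intros [C [HC H]]; exists C; split; [assumption|].
generalize (filter_and _ _ at_right_pos (filter_and _ _ (at_right_lt 1 Rlt_0_1) H)).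
apply filter_imp; intros eps (He & H1 & H') x Px; specialize (H' x Px); simpl in H'.
assert (0 <= C * eps ^ n) by (apply Rmult_le_pos; [|apply pow_le]; lra).
nra.
Qed.

Lemma bigO_mult_approx h h0 k k0 :
  bigO P 0 h0 -> bigO P 0 k0 ->
  bigO P 1 (fun eps x => h eps x - h0 eps x) ->
  bigO P 1 (fun eps x => k eps x - k0 eps x) ->
  bigO P 1 (fun eps x => h eps x * k eps x - h0 eps x * k0 eps x).
Proof.
intros H0 K0 H K.
apply bigO_ext with (fun eps x => (h eps x - h0 eps x) * (k eps x - k0 eps x)
  + h0 eps x * (k eps x - k0 eps x) + (h eps x - h0 eps x) * k0 eps x).
{ intros; ring. }
repeat apply bigO_plus.
- apply bigO_weaken, (bigO_mult 1 1); assumption.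
- apply bigO_mult0l; assumption.
- apply bigO_mult0r; assumption.
Qed.

Lemma bigO_near_0 h : bigO P 1 h -> forall e, 0 < e ->
  at_right 0 (fun eps => forall x, P eps x -> Rabs (h eps x) < e).
Proof.
intros [C [HC H]] e He.
generalize (filter_and _ _ H (at_right_linear C e He)); apply filter_imp.
intros eps [H1 H2] x Px; specialize (H1 x Px); rewrite pow_1 in H1; lra.
Qed.

End BigO.

(** Transfers estimates from stationary points to pairs of a stationary point and a time, which
    gives residual bounds uniform in time. *)
Lemma bigO_comp {X Y : Type} (P : R -> X -> Prop) (Q : R -> Y -> Prop) (n : nat)
    (h : R -> X -> R) (pr : Y -> X) :
  (forall eps y, Q eps y -> P eps (pr y)) ->
  bigO P n h -> bigO Q n (fun eps y => h eps (pr y)).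
Proof.
intros HPQ [C [HC H]]; exists C; split; [assumption|].
revert H; apply filter_imp; auto.
Qed.

Lemma bigO_sin {X : Type} (P : R -> X -> Prop) (h : R -> X -> R) :
  bigO P 0 (fun eps x => sin (h eps x)).
Proof.
exists 1; split; [lra|]; apply filter_forall; intros eps x _; simpl.
pose proof (SIN_bound (h eps x)); apply Rabs_le_between; lra.
Qed.

Lemma bigO_cos {X : Type} (P : R -> X -> Prop) (h : R -> X -> R) :
  bigO P 0 (fun eps x => cos (h eps x)).
Proof.
exists 1; split; [lra|]; apply filter_forall; intros eps x _; simpl.
pose proof (COS_bound (h eps x)); apply Rabs_le_between; lra.
Qed.

Lemma bigO_inv_mult {X : Type} (P : R -> X -> Prop) (h k : R -> X -> R) :
  bigO P 0 (fun eps x => / h eps x) -> bigO P 0 (fun eps x => / k eps x) ->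
  bigO P 0 (fun eps x => / (h eps x * k eps x)).
Proof.
intros H K; apply bigO_ext with (fun eps x => / h eps x * / k eps x).
{ intros; symmetry; apply Rinv_mult. }
apply bigO_mult0l; assumption.
Qed.

Lemma bigO_inv_pow {X : Type} (P : R -> X -> Prop) (h : R -> X -> R) (m : nat) :
  bigO P 0 (fun eps x => / h eps x) -> bigO P 0 (fun eps x => / h eps x ^ m).
Proof.
intros H; apply bigO_ext with (fun eps x => (/ h eps x) ^ m).
{ intros; apply pow_inv. }
apply bigO_pow0, H.
Qed.

Ltac bounded H1 H2 := unfold Rdiv; repeat first
  [ apply bigO_const | apply H1 | apply H2 | apply bigO_sin | apply bigO_cos
  | apply bigO_opp | apply bigO_plus | apply bigO_minus | apply bigO_mult0l
  | apply bigO_pow0 | apply bigO_inv_mult | apply bigO_inv_pow ].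

(** * Folds of the response curve *)

(* Here [K] stands for [3 d a^2 / (8 omega)].  [det0] is the leading determinant of the
   Jacobian, and [response = constant] is the leading frequency-response relation. *)
Definition det0 (sigma lambda K : R) : R := (sigma - K) * (sigma - 3 * K) + lambda ^ 2 / 4.
Definition response (sigma lambda K : R) : R := K * (lambda ^ 2 / 4 + (K - sigma) ^ 2).

(** Completing the square in [sigma] gives [det0 = (sigma - 2 * K) ^ 2 - r ^ 2 / 4] with [r] the
    square root, and the hypothesis reads [2 * K - sigma >= r / 2 >= 0]. *)
Lemma det0_nonneg (sigma lambda K : R) :
  0 <= 4 * K ^ 2 - lambda ^ 2 ->
  sigma <= 2 * K - 1 / 2 * sqrt (4 * K ^ 2 - lambda ^ 2) ->
  0 <= det0 sigma lambda K.
Proof.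
intros H0 H1; unfold det0.
pose proof (sqrt_sqrt _ H0); pose proof (sqrt_pos (4 * K ^ 2 - lambda ^ 2)).
set (r := sqrt _) in *; nra.
Qed.

(** The cubic is [response] minus its value at a critical point [K1], which is a double root. With
    [x = K - K1] and [y = K - K2] it equals [x * (3 * x * y - x ^ 2) / 2], where
    [x ^ 2 <= x * y <= s ^ 2]. *)
Lemma response_near_double_root (K K1 K2 s : R) :
  0 <= s -> 0 <= (K - K1) * (K - K2) <= s ^ 2 -> Rabs (K - K1) <= Rabs (K - K2) ->
  Rabs ((K - K1) ^ 3 - 3 / 2 * (K2 - K1) * (K - K1) ^ 2) <= 2 * s ^ 3.
Proof.
intros Hs [Hpos Hprod] Hle.
replace ((K - K1) ^ 3 - 3 / 2 * (K2 - K1) * (K - K1) ^ 2)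
  with ((K - K1) * ((3 * ((K - K1) * (K - K2)) - (K - K1) * (K - K1)) / 2)) by field.
set (x := K - K1) in *; set (y := K - K2) in *.
assert (Hx2 : x * x <= x * y).
{ rewrite <- (Rabs_pos_eq (x * y)), Rabs_mult by lra.
  pose proof (Rabs_pos x).
  replace (x * x) with (Rabs x * Rabs x) by (rewrite <- Rabs_mult; apply Rabs_pos_eq; nra).
  nra. }
assert (Hx : Rabs x <= s).
{ apply Rsqr_incr_0_var; [|assumption]. rewrite <- Rsqr_abs; unfold Rsqr; nra. }
rewrite Rabs_mult; replace (2 * s ^ 3) with (s * (2 * s ^ 2)) by ring.
apply Rmult_le_compat; auto using Rabs_pos.
rewrite Rabs_pos_eq; nra.
Qed.

(* [det0] is the derivative of [response], so a small nonnegative value of [det0] puts [response]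
   even closer to one of its two critical values. *)
Lemma response_near_critical (sigma lambda : R) :
  exists g1 g2 del, 0 < del /\ forall K s, 0 <= s ->
  s ^ 2 < del -> 0 <= det0 sigma lambda K <= 3 * s ^ 2 ->
  Rabs (response sigma lambda K - g1) <= 2 * s ^ 3 \/ Rabs (response sigma lambda K - g2) <= 2 * s ^ 3.
Proof.
set (D := sigma ^ 2 - 3 / 4 * lambda ^ 2).
destruct (Rlt_le_dec D 0) as [Hneg|Hpos].
(* Without real critical points [det0] is at least [- D / 3 > 0], and this [del] makes its assumed
   smallness contradictory; any two values serve as [g1] and [g2]. *)
- exists 0, 0, (- D / 9); split; [lra|].
  intros K s Hs Hdel [_ Hdet]; exfalso.
  assert (det0 sigma lambda K = 3 * (K - 2 * sigma / 3) ^ 2 - D / 3)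
    by (unfold det0, D; field).
  pose proof (pow2_ge_0 (K - 2 * sigma / 3)); lra.
- pose proof (sqrt_sqrt _ Hpos) as HD; set (r := sqrt D) in HD.
  set (K1 := (2 * sigma - r) / 3); set (K2 := (2 * sigma + r) / 3).
  exists (response sigma lambda K1), (response sigma lambda K2), 1; split; [lra|].
  intros K s Hs _ Hdet.
  assert (Hl : lambda ^ 2 = 4 / 3 * (sigma ^ 2 - r * r)) by (rewrite HD; unfold D; field).
  assert (Hf : det0 sigma lambda K = 3 * ((K - K1) * (K - K2)))
    by (unfold det0, K1, K2; rewrite Hl; field).
  rewrite Hf in Hdet.
  destruct (Rle_dec (Rabs (K - K1)) (Rabs (K - K2))) as [Hle|Hle].
  + left.
    replace (response sigma lambda K - response sigma lambda K1)
      with ((K - K1) ^ 3 - 3 / 2 * (K2 - K1) * (K - K1) ^ 2)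
      by (unfold response, K1, K2; rewrite Hl; field).
    apply response_near_double_root; auto; lra.
  + right.
    replace (response sigma lambda K - response sigma lambda K2)
      with ((K - K2) ^ 3 - 3 / 2 * (K1 - K2) * (K - K2) ^ 2)
      by (unfold response, K1, K2; rewrite Hl; field).
    apply response_near_double_root; auto; lra.
Qed.

(** Applied to [E] and a critical value, both independent of [eps]: the gap [m] is a fixed number
    that [O(eps)] eventually undercuts. *)
Lemma eq_or_apart (x y : R) : exists m, 0 < m /\ (x = y \/ m <= Rabs (x - y)).
Proof.
destruct (Req_dec x y) as [E|E].
- exists 1; split; [lra|auto].
- exists (Rabs (x - y)); split; [apply Rabs_pos_lt; lra|right; lra].
Qed.

(** If [0 <= det0 <= A * eps], then [response] is within [O(eps^(3/2))] of a critical value [g],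
    whereas [E - response] is [eps * H] up to [C * eps ^ 2] with [H >= h0 > 0]. So [E - g] is
    positive yet [O(eps)], and [E] is neither equal to [g] nor at a fixed distance from it. *)
Lemma no_small_det0 (sigma lambda E h0 H1 C A : R) :
  0 < h0 -> 0 <= C -> 0 <= A ->
  at_right 0 (fun eps => forall K H, h0 <= H <= H1 ->
    Rabs (E - response sigma lambda K - eps * H) <= C * eps ^ 2 ->
    0 <= det0 sigma lambda K -> A * eps < det0 sigma lambda K).
Proof.
intros Hh0 HC HA.
destruct (response_near_critical sigma lambda) as (g1 & g2 & del & Hdel & Hcrit).
destruct (eq_or_apart E g1) as (m1 & Hm1 & Hg1).
destruct (eq_or_apart E g2) as (m2 & Hm2 & Hg2).
(* Chosen so that [s <= tau] forces [2 * s ^ 3 <= eps * h0 / 3], while [tau < 1] gives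
   [2 * s ^ 3 <= A * eps]. *)
set (tau := h0 / (2 * A + 4 * h0)).
assert (Htau : 0 < tau) by (apply Rdiv_lt_0_compat; lra).
assert (Ht1 : tau < 1) by (apply Rlt_div_l; lra).
assert (HAtau : 2 * A * tau <= h0).
{ unfold tau; replace (2 * A * (h0 / (2 * A + 4 * h0))) with (2 * A * h0 / (2 * A + 4 * h0)) by (field; lra).
  apply Rle_div_l; nra. }
assert (Hh4 : 0 < h0 / 4) by lra.
generalize (filter_and _ _ at_right_pos (filter_and _ _ (at_right_lt 1 Rlt_0_1)
  (filter_and _ _ (at_right_linear A del Hdel)
  (filter_and _ _ (at_right_linear A (tau ^ 2) (pow_lt _ _ Htau))
  (filter_and _ _ (at_right_linear C (h0 / 4) Hh4)
  (filter_and _ _ (at_right_linear (H1 + A + C) m1 Hm1)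
     (at_right_linear (H1 + A + C) m2 Hm2))))))).
apply filter_imp; intros eps (Hp & He1 & HAd & HAt & HCh & HM1 & HM2) K H HH HE Hdet.
apply Rnot_le_lt; intros Hle.
assert (HAe : 0 <= A * eps) by nra.
set (s := sqrt (A * eps / 3)).
assert (Hs0 : 0 <= s) by apply sqrt_pos.
assert (Hs : s ^ 2 = A * eps / 3) by (unfold s; rewrite pow2_sqrt; lra).
assert (Hstau : s <= tau) by nra.
assert (Hs3 : 2 * s ^ 3 <= eps * h0 / 3).
{ replace (s ^ 3) with (s ^ 2 * s) by ring; rewrite Hs.
  apply Rle_trans with (2 * (A * eps / 3 * tau)); nra. }
assert (Hs3' : 2 * s ^ 3 <= A * eps).
{ replace (s ^ 3) with (s ^ 2 * s) by ring; rewrite Hs; nra. }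
assert (Hcontra : forall g m, 0 < m -> (E = g \/ m <= Rabs (E - g)) ->
  (H1 + A + C) * eps < m -> Rabs (response sigma lambda K - g) <= 2 * s ^ 3 -> False).
{ intros g m Hm Hor HMm Hclose.
  apply Rabs_le_between in HE; apply Rabs_le_between in Hclose.
  (* The losses are below [eps * h0 / 4] from [C * eps ^ 2] and at most [eps * h0 / 3] from
     [2 * s ^ 3], so part of [eps * h0] survives. *)
  assert (Hlo : 0 < E - g) by nra.
  destruct Hor as [->|Hor]; [lra|].
  rewrite Rabs_pos_eq in Hor by lra; nra. }
destruct (Hcrit K s Hs0 ltac:(lra) ltac:(lra)) as [Hc|Hc]; eauto.
Qed.

(** With [x = sigma - K] the hypothesis bounds [x * (2 * K - x)] below. It yields
    [K * x >= lambda ^ 2 / 16], so [K] and [x] have the same sign, and it controls [x ^ 2] by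
    [2 * K * x], so the last factor is at least [2 * K ^ 2]. *)
Lemma fold_shift_lower_bound (sigma lambda K e : R) :
  0 <= e -> lambda ^ 2 / 8 <= (sigma - K) * (3 * K - sigma) ->
  lambda ^ 2 * K ^ 2 / 4 <=
  K * (2 * (sigma - K) * (3 * K * sigma - sigma ^ 2 / 2 - K ^ 2 / 12 + e)).
Proof.
intros He Hdet.
set (x := sigma - K) in *.
replace (3 * K * sigma - sigma ^ 2 / 2 - K ^ 2 / 12 + e)
  with (29 / 12 * K ^ 2 + 2 * (K * x) - x ^ 2 / 2 + e) by (unfold x; field).
replace (3 * K - sigma) with (2 * K - x) in Hdet by (unfold x; ring).
assert (HKx : lambda ^ 2 / 16 <= K * x) by nra.
pose proof (pow2_ge_0 lambda).
assert (2 * K ^ 2 <= 29 / 12 * K ^ 2 + 2 * (K * x) - x ^ 2 / 2 + e) by nra.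
set (B := 29 / 12 * K ^ 2 + 2 * (K * x) - x ^ 2 / 2 + e) in *.
replace (K * (2 * x * B)) with (2 * (K * x) * B) by ring.
pose proof (pow2_ge_0 K).
apply Rle_trans with (2 * (lambda ^ 2 / 16) * (2 * K ^ 2)); [lra|].
apply Rmult_le_compat; lra.
Qed.

(** * The amplitude-phase system *)

(** Differentiability needs one partial derivative near the point, continuous there, and the other
    only at the point itself. *)
Lemma differentiable_of_partials (f dfx : R -> R -> R) (x y dfy : R) :
  locally_2d (fun u v => is_derive (fun z => f z v) u (dfx u v)) x y ->
  continuity_2d_pt dfx x y ->
  is_derive (fun z => f x z) y dfy ->
  differentiable_pt_lim f x y (dfx x y) dfy.
Proof.
intros Hx Hc Hy; apply filterdiff_differentiable_pt_lim.
apply (is_derive_filterdiff f x y dfx dfy).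
- apply (proj1 (locally_2d_locally _ x y)) in Hx; exact Hx.
- exact Hy.
- apply (proj1 (continuity_2d_pt_filterlim dfx x y) Hc).
Qed.

Lemma differentiable_pt_lim_plus (f g : R -> R -> R) (x y fx fy gx gy : R) :
  differentiable_pt_lim f x y fx fy -> differentiable_pt_lim g x y gx gy ->
  differentiable_pt_lim (fun u v => f u v + g u v) x y (fx + gx) (fy + gy).
Proof.
intros Hf Hg e.
generalize (locally_2d_and _ _ x y (Hf (pos_div_2 e)) (Hg (pos_div_2 e))).
apply locally_2d_impl, locally_2d_forall; intros u v [H1 H2]; simpl in H1, H2.
replace (f u v + g u v - (f x y + g x y) - ((fx + gx) * (u - x) + (fy + gy) * (v - y)))
  with ((f u v - f x y - (fx * (u - x) + fy * (v - y)))
      + (g u v - g x y - (gx * (u - x) + gy * (v - y)))) by ring.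
apply Rle_trans with (1 := Rabs_triang _ _); lra.
Qed.

Ltac nonzero := repeat split; first [assumption | lra].

Lemma in_box_nonzero (M a b : R) : 0 < M -> in_box M a b -> a <> 0.
Proof.
intros HM [[Ha _] _] ->; rewrite Rabs_R0 in Ha.
pose proof (Rinv_0_lt_compat _ HM); lra.
Qed.

Lemma in_box_nbhd (M a b : R) : 0 < M -> in_box M a b ->
  locally_2d (in_box (2 * M)) a b.
Proof.
intros HM [[Ha1 Ha2] Hb].
pose proof (Rinv_0_lt_compat _ HM) as HI.
assert (He : 0 < Rmin (/ M / 2) M) by (apply Rmin_pos; lra).
exists (mkposreal _ He); simpl; intros u v Hu Hv.
pose proof (Rmin_l (/ M / 2) M); pose proof (Rmin_r (/ M / 2) M).
pose proof (Rabs_triang_inv a u); rewrite Rabs_minus_sym in Hu.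
pose proof (Rabs_triang_inv u a); rewrite Rabs_minus_sym in Hu.
pose proof (Rabs_triang_inv v b).
rewrite (Rabs_minus_sym a u) in *.
unfold in_box; replace (/ (2 * M)) with (/ M / 2) by (field; lra); lra.
Qed.

Lemma third_order_bigO (r : R -> R -> R -> R) (M : R) (P : R -> R * R -> Prop) :
  0 < M -> third_order r -> (forall eps x, P eps x -> in_box M (fst x) (snd x)) ->
  bigO P 3 (fun eps x => r eps (fst x) (snd x)) /\
  bigO P 3 (fun eps x => Derive (fun z => r eps z (snd x)) (fst x)) /\
  bigO P 3 (fun eps x => Derive (fun z => r eps (fst x) z) (snd x)).
Proof.
intros HM Hr HP; destruct (Hr M HM) as (C & e & He & H).
(* [third_order] does not fix the sign of its constant, whereas [bigO] asks for a nonnegative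
   one. *)
repeat split; exists (Rabs C); (split; [apply Rabs_pos|]);
  apply at_right_interval; exists e; (split; [assumption|]); intros eps Heps x Px;
  destruct (H eps (fst x) (snd x) Heps (HP eps x Px)) as (_ & _ & _ & _ & H1 & H2 & H3);
  assert (C * eps ^ 3 <= Rabs C * eps ^ 3)
    by (apply Rmult_le_compat_r; [apply pow_le; lra|apply Rle_abs]); lra.
Qed.

Lemma third_order_differentiable (r : R -> R -> R -> R) (M : R) :
  0 < M -> third_order r ->
  at_right 0 (fun eps => forall a b, in_box M a b ->
    differentiable_pt_lim (r eps) a b
      (Derive (fun z => r eps z b) a) (Derive (fun z => r eps a z) b)).
Proof.
(* The box of size [2 * M] contains a neighbourhood of every point of the box of size [M], including
   its boundary points. *)
intros HM Hr; destruct (Hr (2 * M) ltac:(lra)) as (C & e & He & H).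
apply at_right_interval; exists e; split; [assumption|]; intros eps Heps a b Hab.
pose proof (in_box_nbhd M a b HM Hab) as Hnb.
destruct (H eps a b Heps (locally_2d_singleton _ _ _ Hnb)) as (_ & Hy & Hc & _).
apply (differentiable_of_partials (r eps) (fun x y => Derive (fun z => r eps z y) x)).
- revert Hnb; apply locally_2d_impl, locally_2d_forall; intros u v Huv.
  apply Derive_correct, (H eps u v Heps Huv).
- exact Hc.
- apply Derive_correct, Hy.
Qed.

Section AmplitudePhase.

Variables (omega lambda c d Fm sigma : R) (r1 r2 : R -> R -> R -> R) (M : R).
Hypothesis (homega : 0 < omega) (hlambda : 0 < lambda).
Hypothesis (hr1 : third_order r1) (hr2 : third_order r2) (hM : 0 < M).

Let f := amplitude_rhs omega lambda d Fm sigma r1.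
Let g := phase_rhs omega lambda c d Fm sigma r2.

(** * Coefficients of the right-hand sides and entries of the Jacobian *)

Definition amp1 (a b : R) : R := - (Fm * sin b / (2 * omega)) - lambda * a / 2.
Definition amp2 (a b : R) : R :=
  3 * d * lambda * a ^ 3 / (16 * omega ^ 2) + sigma * Fm * sin b / (4 * omega ^ 2)
  + lambda * Fm * cos b / (8 * omega ^ 2) + 9 * d * a ^ 2 * Fm * sin b / (32 * omega ^ 3).
Definition phase1 (a b : R) : R :=
  - sigma + 3 * d * a ^ 2 / (8 * omega) - Fm * cos b / (2 * a * omega).
Definition phase2 (a b : R) : R :=
  - (lambda ^ 2 / (8 * omega)) - 15 * d ^ 2 * a ^ 4 / (256 * omega ^ 3)
  - 5 * c ^ 2 * a ^ 2 / (12 * omega ^ 3) + sigma * Fm * cos b / (4 * omega ^ 2 * a)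
  + 3 * d * a * Fm * cos b / (32 * omega ^ 3) - lambda * Fm * sin b / (8 * omega ^ 2 * a).

Definition amp2_a (a b : R) : R :=
  9 * d * lambda * a ^ 2 / (16 * omega ^ 2) + 9 * d * a * Fm * sin b / (16 * omega ^ 3).
Definition amp2_b (a b : R) : R :=
  sigma * Fm * cos b / (4 * omega ^ 2) - lambda * Fm * sin b / (8 * omega ^ 2)
  + 9 * d * a ^ 2 * Fm * cos b / (32 * omega ^ 3).
Definition phase2_a (a b : R) : R :=
  - (15 * d ^ 2 * a ^ 3 / (64 * omega ^ 3)) - 5 * c ^ 2 * a / (6 * omega ^ 3)
  - sigma * Fm * cos b / (4 * omega ^ 2 * a ^ 2) + 3 * d * Fm * cos b / (32 * omega ^ 3)
  + lambda * Fm * sin b / (8 * omega ^ 2 * a ^ 2).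
Definition phase2_b (a b : R) : R :=
  - (sigma * Fm * sin b / (4 * omega ^ 2 * a)) - 3 * d * a * Fm * sin b / (32 * omega ^ 3)
  - lambda * Fm * cos b / (8 * omega ^ 2 * a).

Definition jac_aa (eps : R) (x : R * R) : R :=
  eps * (- (lambda / 2)) + eps ^ 2 * amp2_a (fst x) (snd x)
  + Derive (fun z => r1 eps z (snd x)) (fst x).
Definition jac_ab (eps : R) (x : R * R) : R :=
  eps * (- (Fm * cos (snd x) / (2 * omega))) + eps ^ 2 * amp2_b (fst x) (snd x)
  + Derive (fun z => r1 eps (fst x) z) (snd x).
Definition jac_ba (eps : R) (x : R * R) : R :=
  eps * (3 * d * fst x / (4 * omega) + Fm * cos (snd x) / (2 * omega * fst x ^ 2))
  + eps ^ 2 * phase2_a (fst x) (snd x) + Derive (fun z => r2 eps z (snd x)) (fst x).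
Definition jac_bb (eps : R) (x : R * R) : R :=
  eps * (Fm * sin (snd x) / (2 * fst x * omega)) + eps ^ 2 * phase2_b (fst x) (snd x)
  + Derive (fun z => r2 eps (fst x) z) (snd x).

Ltac cont2d := repeat first
  [ apply continuity_2d_pt_const | apply continuity_2d_pt_id1 | apply continuity_2d_pt_id2
  | apply continuity_2d_pt_plus | apply continuity_2d_pt_minus | apply continuity_2d_pt_opp
  | apply continuity_2d_pt_mult | apply continuity_2d_pt_inv
  | apply (continuity_1d_2d_pt_comp sin); [apply continuity_sin|]
  | apply (continuity_1d_2d_pt_comp cos); [apply continuity_cos|] ].

Lemma amplitude_differentiable :
  at_right 0 (fun eps => forall x, in_box M (fst x) (snd x) ->
    differentiable_pt_lim (f eps) (fst x) (snd x) (jac_aa eps x) (jac_ab eps x)).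
Proof.
generalize (third_order_differentiable r1 M hM hr1); apply filter_imp.
intros eps H [a b] Hab; specialize (H a b Hab); simpl fst in *; simpl snd in *.
apply differentiable_pt_lim_plus; [|exact H].
apply (differentiable_of_partials
  (fun a b => eps * amp1 a b + eps ^ 2 * amp2 a b)
  (fun a b => eps * (- (lambda / 2)) + eps ^ 2 * amp2_a a b)).
- apply locally_2d_forall; intros u v; unfold amp1, amp2, amp2_a.
  auto_derive; [trivial|field; lra].
- unfold amp2_a, Rdiv, pow; cont2d.
- unfold amp1, amp2, amp2_b; simpl fst; simpl snd; auto_derive; [trivial|field; lra].
Qed.

Lemma phase_differentiable :
  at_right 0 (fun eps => forall x, in_box M (fst x) (snd x) ->
    differentiable_pt_lim (g eps) (fst x) (snd x) (jac_ba eps x) (jac_bb eps x)).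
Proof.
generalize (third_order_differentiable r2 M hM hr2); apply filter_imp.
intros eps H [a b] Hab; specialize (H a b Hab); simpl fst in *; simpl snd in *.
apply differentiable_pt_lim_plus; [|exact H].
assert (Ha := in_box_nonzero M a b hM Hab).
apply (differentiable_of_partials
  (fun a b => eps * phase1 a b + eps ^ 2 * phase2 a b)
  (fun a b => eps * (3 * d * a / (4 * omega) + Fm * cos b / (2 * omega * a ^ 2))
            + eps ^ 2 * phase2_a a b)).
- assert (Hm : 0 < 2 * M) by lra.
  generalize (in_box_nbhd M a b hM Hab).
  apply locally_2d_impl, locally_2d_forall; intros u v Huv.
  apply (in_box_nonzero _ _ _ Hm) in Huv; unfold phase1, phase2, phase2_a.
  auto_derive; [repeat split; repeat apply Rmult_integral_contrapositive_currified;
     try apply pow_nonzero; first [assumption | lra]|field; lra].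
- unfold phase2_a, Rdiv, pow; cont2d;
    repeat apply Rmult_integral_contrapositive_currified; simpl; first [assumption | lra].
- unfold phase1, phase2, phase2_b; simpl fst; simpl snd; auto_derive; [trivial|field; lra].
Qed.


(** * Estimates at the stationary points of a box *)

Let pts (eps : R) (x : R * R) : Prop :=
  in_box M (fst x) (snd x) /\ stationary (f eps) (g eps) (fst x) (snd x).

Let K (x : R * R) : R := 3 * d * fst x ^ 2 / (8 * omega).

Lemma pts_nonzero eps x : pts eps x -> fst x <> 0.
Proof. intros [H _]; exact (in_box_nonzero M _ _ hM H). Qed.

Lemma pts_in_box eps x : pts eps x -> in_box M (fst x) (snd x).
Proof. intros [H _]; exact H. Qed.

Lemma bigO_a : bigO pts 0 (fun _ x => fst x).
Proof.
exists M; split; [lra|]; apply filter_forall; intros eps x [[[_ H] _] _]; simpl; lra.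
Qed.

Lemma bigO_inv_a : bigO pts 0 (fun _ x => / fst x).
Proof.
exists M; split; [lra|]; apply filter_forall; intros eps x Hx.
pose proof (pts_nonzero _ _ Hx) as Ha; destruct Hx as [[[H _] _] _].
rewrite Rabs_inv; simpl; rewrite Rmult_1_r, <- (Rinv_inv M).
apply Rinv_le_contravar; [apply Rinv_0_lt_compat; lra|assumption].
Qed.

Lemma bigO_amp2 : bigO pts 0 (fun _ x => amp2 (fst x) (snd x)).
Proof. unfold amp2; bounded bigO_a bigO_inv_a. Qed.

Lemma bigO_phase2 : bigO pts 0 (fun _ x => phase2 (fst x) (snd x)).
Proof. unfold phase2; bounded bigO_a bigO_inv_a. Qed.

Let hr1O := third_order_bigO r1 M pts hM hr1 pts_in_box.
Let hr2O := third_order_bigO r2 M pts hM hr2 pts_in_box.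

(** Dividing the stationarity equation by [eps] leaves only [- r1 / eps], which is of second
    order. *)
Lemma amp1_second_order :
  bigO pts 2 (fun eps x => amp1 (fst x) (snd x) + eps * amp2 (fst x) (snd x)).
Proof.
apply bigO_ext with (fun eps x => - (r1 eps (fst x) (snd x) / eps)).
{ intros eps x Heps [_ (_ & H & _)]; unfold f, amplitude_rhs in H.
  fold (amp1 (fst x) (snd x)) in H; fold (amp2 (fst x) (snd x)) in H.
  apply Rmult_eq_reg_l with eps; [|lra]; field_simplify; [|lra]; lra. }
apply bigO_opp, bigO_div_eps, hr1O.
Qed.

Lemma phase1_second_order :
  bigO pts 2 (fun eps x => phase1 (fst x) (snd x) + eps * phase2 (fst x) (snd x)).
Proof.
apply bigO_ext with (fun eps x => - (r2 eps (fst x) (snd x) / eps)).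
{ intros eps x Heps [_ (_ & _ & H)]; unfold g, phase_rhs in H.
  fold (phase1 (fst x) (snd x)) in H; fold (phase2 (fst x) (snd x)) in H.
  apply Rmult_eq_reg_l with eps; [|lra]; field_simplify; [|lra]; lra. }
apply bigO_opp, bigO_div_eps, hr2O.
Qed.

Lemma bigO_amp1 : bigO pts 1 (fun _ x => amp1 (fst x) (snd x)).
Proof.
apply bigO_ext with (fun eps x => (amp1 (fst x) (snd x) + eps * amp2 (fst x) (snd x))
  - eps ^ 1 * amp2 (fst x) (snd x)); [intros; ring|].
apply bigO_minus; [apply bigO_weaken, amp1_second_order|].
apply bigO_mult0r; [apply bigO_eps|apply bigO_amp2].
Qed.

Lemma bigO_phase1 : bigO pts 1 (fun _ x => phase1 (fst x) (snd x)).
Proof.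
apply bigO_ext with (fun eps x => (phase1 (fst x) (snd x) + eps * phase2 (fst x) (snd x))
  - eps ^ 1 * phase2 (fst x) (snd x)); [intros; ring|].
apply bigO_minus; [apply bigO_weaken, phase1_second_order|].
apply bigO_mult0r; [apply bigO_eps|apply bigO_phase2].
Qed.

(** An identity at every point. At stationary points [amp1] is [O(eps)], so it expresses [Fm * sin]
    through the amplitude to leading order and keeps the exact error; [cos_stationary] does the same
    with [phase1]. *)
Lemma sin_stationary x : Fm * sin (snd x) = - lambda * fst x * omega - 2 * omega * amp1 (fst x) (snd x).
Proof. unfold amp1; field; nonzero. Qed.

Lemma cos_stationary x : fst x <> 0 ->
  Fm * cos (snd x) = 2 * fst x * omega * (K x - sigma) - 2 * fst x * omega * phase1 (fst x) (snd x).
Proof. intros Ha; unfold K, phase1; field; nonzero. Qed.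

(** Here [h0] is the leading coefficient after elimination of the phase, and [k1] is the defect left
    by that elimination, a multiple of [amp1] or [phase1]. *)
Lemma jac_entry (h h0 k1 k2 r : R -> R * R -> R) :
  (forall eps x, 0 < eps -> pts eps x -> h eps x = eps * (h0 eps x + k1 eps x) + eps ^ 2 * k2 eps x + r eps x) ->
  bigO pts 1 k1 -> bigO pts 0 k2 -> bigO pts 3 r ->
  bigO pts 1 (fun eps x => h eps x / eps - h0 eps x).
Proof.
intros E H1 H2 H3.
apply bigO_ext with (fun eps x => k1 eps x + eps ^ 1 * k2 eps x + r eps x / eps).
{ intros eps x Heps Px; rewrite (E eps x Heps Px); field; nonzero. }
repeat apply bigO_plus; [assumption| |apply bigO_weaken, bigO_div_eps, H3].
apply bigO_mult0r; [apply bigO_eps|assumption].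
Qed.

Lemma jac_aa_leading : bigO pts 1 (fun eps x => jac_aa eps x / eps - - (lambda / 2)).
Proof.
(* This entry contains no phase at first order, so the defect is zero, written as [0 * eps ^ 1] to
   make its order visible. *)
apply (jac_entry jac_aa (fun _ _ => - (lambda / 2)) (fun eps _ => 0 * eps ^ 1)
  (fun _ x => amp2_a (fst x) (snd x)) (fun eps x => Derive (fun z => r1 eps z (snd x)) (fst x))).
- intros; unfold jac_aa; ring.
- apply bigO_mult0l; [apply bigO_const|apply bigO_eps].
- unfold amp2_a; bounded bigO_a bigO_inv_a.
- apply hr1O.
Qed.

Lemma jac_ab_leading : bigO pts 1 (fun eps x => jac_ab eps x / eps - fst x * (sigma - K x)).
Proof.
apply (jac_entry jac_ab (fun _ x => fst x * (sigma - K x)) (fun _ x => fst x * phase1 (fst x) (snd x))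
  (fun _ x => amp2_b (fst x) (snd x)) (fun eps x => Derive (fun z => r1 eps (fst x) z) (snd x))).
- intros eps x _ Hx; unfold jac_ab.
  rewrite (cos_stationary x (pts_nonzero _ _ Hx)); field; nonzero.
- apply bigO_mult0l; [apply bigO_a|apply bigO_phase1].
- unfold amp2_b; bounded bigO_a bigO_inv_a.
- apply hr1O.
Qed.

Lemma jac_ba_leading : bigO pts 1 (fun eps x => jac_ba eps x / eps - (3 * K x - sigma) * / fst x).
Proof.
apply (jac_entry jac_ba (fun _ x => (3 * K x - sigma) * / fst x)
  (fun _ x => - (/ fst x * phase1 (fst x) (snd x)))
  (fun _ x => phase2_a (fst x) (snd x)) (fun eps x => Derive (fun z => r2 eps z (snd x)) (fst x))).
- intros eps x _ Hx; unfold jac_ba; pose proof (pts_nonzero _ _ Hx) as Ha.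
  rewrite (cos_stationary x Ha); unfold K; field; nonzero.
- apply bigO_opp, bigO_mult0l; [apply bigO_inv_a|apply bigO_phase1].
- unfold phase2_a; bounded bigO_a bigO_inv_a.
- apply hr2O.
Qed.

Lemma jac_bb_leading : bigO pts 1 (fun eps x => jac_bb eps x / eps - - (lambda / 2)).
Proof.
apply (jac_entry jac_bb (fun _ x => - (lambda / 2))
  (fun _ x => - (/ fst x * amp1 (fst x) (snd x)))
  (fun _ x => phase2_b (fst x) (snd x)) (fun eps x => Derive (fun z => r2 eps (fst x) z) (snd x))).
- intros eps x _ Hx; unfold jac_bb; pose proof (pts_nonzero _ _ Hx) as Ha.
  rewrite (sin_stationary x); field; nonzero.
- apply bigO_opp, bigO_mult0l; [apply bigO_inv_a|apply bigO_amp1].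
- unfold phase2_b; bounded bigO_a bigO_inv_a.
- apply hr2O.
Qed.

Lemma bigO_K : bigO pts 0 (fun _ x => K x).
Proof. unfold K; bounded bigO_a bigO_inv_a. Qed.

Lemma trace_negative :
  at_right 0 (fun eps => forall x, pts eps x -> jac_aa eps x + jac_bb eps x < 0).
Proof.
generalize (filter_and _ _ at_right_pos
  (bigO_near_0 pts _ (bigO_plus pts 1 _ _ jac_aa_leading jac_bb_leading) lambda hlambda)).
apply filter_imp; intros eps [Heps H] x Hx; specialize (H x Hx).
apply Rabs_lt_between in H.
replace (jac_aa eps x + jac_bb eps x) with (eps * (jac_aa eps x / eps + jac_bb eps x / eps))
  by (field; nonzero).
nra.
Qed.

(** The diagonal contributes [lambda ^ 2 / 4]. In the product of the off-diagonal entries the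
    factors [a] and [/ a] cancel, leaving [(sigma - K) * (3 * K - sigma)]. *)
Lemma det_leading : bigO pts 1 (fun eps x =>
  (jac_aa eps x * jac_bb eps x - jac_ab eps x * jac_ba eps x) / eps ^ 2
  - det0 sigma lambda (K x)).
Proof.
assert (H1 := bigO_mult_approx pts _ _ _ _ (bigO_const _ _) (bigO_const _ _)
  jac_aa_leading jac_bb_leading).
assert (H2 := bigO_mult_approx pts _ _ _ _
  (bigO_mult0l pts 0 _ _ bigO_a (bigO_minus pts 0 _ _ (bigO_const _ sigma) bigO_K))
  (bigO_mult0l pts 0 _ _ (bigO_minus pts 0 _ _
     (bigO_mult0l pts 0 _ _ (bigO_const _ 3) bigO_K) (bigO_const _ sigma)) bigO_inv_a)
  jac_ab_leading jac_ba_leading).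
apply (bigO_ext pts 1) with (2 := bigO_minus pts 1 _ _ H1 H2).
intros eps x Heps Hx; unfold det0; simpl; field; pose proof (pts_nonzero _ _ Hx); nonzero.
Qed.

(* Eliminating the phase with [sin^2 + cos^2 = 1] turns stationarity into one equation for
   the amplitude: the leading response curve, shifted by [eps * shift]. *)
Let shift (x : R * R) : R :=
  K x / omega * (lambda ^ 2 * sigma / 2 + 2 * (K x - sigma)
    * (K x ^ 2 / 12 - sigma ^ 2 / 2 - 5 * c ^ 2 * fst x ^ 2 / (12 * omega ^ 2))).

(** The factor for which [K x = kappa * fst x ^ 2]; it turns the relation for [Fm ^ 2] into one for
    [response]. *)
Let kappa : R := 3 * d / (8 * omega).

(** Inserting the leading values of [Fm * sin] and [Fm * cos] makes all terms in [a ^ 3] cancel. *)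
Lemma amp2_leading : bigO pts 1 (fun _ x =>
  amp2 (fst x) (snd x) - - (lambda * fst x * sigma / (2 * omega))).
Proof.
apply bigO_ext with (fun _ x =>
  (- (2 * omega) * (sigma / (4 * omega ^ 2) + 9 * d * fst x ^ 2 / (32 * omega ^ 3))) * amp1 (fst x) (snd x)
  + (- (lambda * (2 * fst x * omega) / (8 * omega ^ 2))) * phase1 (fst x) (snd x)).
{ intros eps x _ Hx; pose proof (pts_nonzero _ _ Hx) as Ha.
  replace (amp2 (fst x) (snd x)) with
    (3 * d * lambda * fst x ^ 3 / (16 * omega ^ 2) + sigma * (Fm * sin (snd x)) / (4 * omega ^ 2)
     + lambda * (Fm * cos (snd x)) / (8 * omega ^ 2)
     + 9 * d * fst x ^ 2 * (Fm * sin (snd x)) / (32 * omega ^ 3))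
    by (unfold amp2; field; nonzero).
  rewrite (cos_stationary x Ha), (sin_stationary x); unfold K; field; nonzero. }
apply bigO_plus; (apply bigO_mult0l; [|apply bigO_amp1 || apply bigO_phase1]);
  bounded bigO_a bigO_inv_a.
Qed.

(** After the same substitution the terms in [lambda ^ 2] cancel, and so do those in [K * sigma]. *)
Lemma phase2_leading : bigO pts 1 (fun _ x => phase2 (fst x) (snd x)
  - (K x ^ 2 / 12 - sigma ^ 2 / 2 - 5 * c ^ 2 * fst x ^ 2 / (12 * omega ^ 2)) / omega).
Proof.
apply bigO_ext with (fun _ x =>
  (- (2 * fst x * omega) * (sigma / (4 * omega ^ 2 * fst x) + 3 * d * fst x / (32 * omega ^ 3)))
    * phase1 (fst x) (snd x)
  + lambda * (2 * omega) / (8 * omega ^ 2 * fst x) * amp1 (fst x) (snd x)).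
{ intros eps x _ Hx; pose proof (pts_nonzero _ _ Hx) as Ha.
  replace (phase2 (fst x) (snd x)) with
    (- (lambda ^ 2 / (8 * omega)) - 15 * d ^ 2 * fst x ^ 4 / (256 * omega ^ 3)
     - 5 * c ^ 2 * fst x ^ 2 / (12 * omega ^ 3) + sigma * (Fm * cos (snd x)) / (4 * omega ^ 2 * fst x)
     + 3 * d * fst x * (Fm * cos (snd x)) / (32 * omega ^ 3)
     - lambda * (Fm * sin (snd x)) / (8 * omega ^ 2 * fst x))
    by (unfold phase2; field; nonzero).
  rewrite (cos_stationary x Ha), (sin_stationary x); unfold K; field; nonzero. }
apply bigO_plus; (apply bigO_mult0l; [|apply bigO_amp1 || apply bigO_phase1]);
  bounded bigO_a bigO_inv_a.
Qed.

Lemma response_equation : bigO pts 2 (fun eps x =>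
  kappa * (Fm ^ 2 / (4 * omega ^ 2)) - response sigma lambda (K x) - eps * shift x).
Proof.
set (A1 := fun (_ : R) (x : R * R) => amp1 (fst x) (snd x)).
set (B1 := fun (_ : R) (x : R * R) => phase1 (fst x) (snd x)).
set (A2 := fun (eps : R) (x : R * R) => amp1 (fst x) (snd x) + eps * amp2 (fst x) (snd x)).
set (B2 := fun (eps : R) (x : R * R) => phase1 (fst x) (snd x) + eps * phase2 (fst x) (snd x)).
set (dA := fun (_ : R) (x : R * R) => amp2 (fst x) (snd x) - - (lambda * fst x * sigma / (2 * omega))).
set (dB := fun (_ : R) (x : R * R) => phase2 (fst x) (snd x)
  - (K x ^ 2 / 12 - sigma ^ 2 / 2 - 5 * c ^ 2 * fst x ^ 2 / (12 * omega ^ 2)) / omega).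
(* Expansion of [kappa * Fm ^ 2 / (4 * omega ^ 2)] in [amp1] and [phase1]. The squares are
   [O(eps^2)]. In the linear terms [amp1] is [A2 - eps * amp2], and similarly for [phase1]; the
   leading parts of [amp2] and [phase2] add up to [eps * shift]. *)
apply bigO_ext with (fun eps x =>
  kappa * (A1 eps x * A1 eps x) + kappa * fst x ^ 2 * (B1 eps x * B1 eps x)
  + kappa * lambda * fst x * (A2 eps x - eps ^ 1 * dA eps x)
  - kappa * 2 * fst x ^ 2 * (K x - sigma) * (B2 eps x - eps ^ 1 * dB eps x)).
{ intros eps x Heps Hx; pose proof (pts_nonzero _ _ Hx) as Ha.
  assert (HF : Fm ^ 2 = (Fm * sin (snd x)) ^ 2 + (Fm * cos (snd x)) ^ 2).
  { pose proof (sin2_cos2 (snd x)) as Hsc; unfold Rsqr in Hsc.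
    replace (Fm ^ 2) with (Fm ^ 2 * (sin (snd x) * sin (snd x) + cos (snd x) * cos (snd x)))
      by (rewrite Hsc; ring); ring. }
  rewrite HF, (cos_stationary x Ha), (sin_stationary x).
  unfold A1, B1, A2, B2, dA, dB, response, shift, K, kappa; field; nonzero. }
assert (HK := bigO_K).
apply bigO_minus; [repeat apply bigO_plus|].
- apply bigO_mult0l; [apply bigO_const|]; apply (bigO_mult pts 1 1); apply bigO_amp1.
- apply bigO_mult0l; [bounded bigO_a bigO_inv_a|]; apply (bigO_mult pts 1 1); apply bigO_phase1.
- apply bigO_mult0l; [bounded bigO_a bigO_inv_a|]; apply bigO_minus; [apply amp1_second_order|].
  apply (bigO_mult pts 1 1); [apply bigO_eps|apply amp2_leading].
- apply bigO_mult0l; [bounded bigO_a bigO_K|]; apply bigO_minus; [apply phase1_second_order|].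
  apply (bigO_mult pts 1 1); [apply bigO_eps|apply phase2_leading].
Qed.

(* Near a fold [shift] is positive and bounded away from [0], so stationary points keep a
   distance of order at least [sqrt eps] from it. *)
Lemma det0_large (A : R) : d <> 0 -> 0 <= A ->
  at_right 0 (fun eps => forall x, pts eps x ->
    0 <= det0 sigma lambda (K x) -> A * eps < det0 sigma lambda (K x)).
Proof.
intros Hd HA.
destruct response_equation as (C & HC & Hresp).
assert (Hshift : bigO pts 0 (fun _ x => shift x)) by (unfold shift; bounded bigO_a bigO_K).
destruct Hshift as (H1 & _ & Hshift).
assert (HKs : bigO pts 0 (fun _ x => K x * sigma)) by bounded bigO_a bigO_K.
destruct HKs as (B & HB & HKs).
(* A lower bound of [Rabs (K x)] on the box, from [/ M <= Rabs a]. *)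
set (km := Rabs kappa / M ^ 2).
assert (Hkm : 0 < km).
{ apply Rdiv_lt_0_compat; [|apply pow_lt; lra].
  apply Rabs_pos_lt; unfold kappa, Rdiv; apply Rmult_integral_contrapositive_currified.
  - lra.
  - apply Rinv_neq_0_compat; lra. }
(* Half of the lower bound given by [fold_shift_lower_bound]; the other half absorbs the term
   [2 * det0 * (K * sigma)], which is at least [- 2 * A * B * eps]. *)
set (h := lambda ^ 2 * km ^ 2 / 8).
assert (Hh : 0 < h) by (unfold h; pose proof (pow_lt _ 2 hlambda); pose proof (pow_lt _ 2 Hkm); nra).
assert (Hh0 : 0 < h / omega) by (apply Rdiv_lt_0_compat; assumption).
assert (Hl8 : 0 < lambda ^ 2 / 8) by (pose proof (pow_lt _ 2 hlambda); lra).
generalize (filter_and _ _ at_right_pos (filter_and _ _ Hresp (filter_and _ _ Hshift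
  (filter_and _ _ HKs (filter_and _ _ (at_right_linear A _ Hl8)
  (filter_and _ _ (at_right_linear (2 * A * B) h Hh)
    (no_small_det0 sigma lambda (kappa * (Fm ^ 2 / (4 * omega ^ 2))) (h / omega) H1 C A Hh0 HC HA))))))).
apply filter_imp.
intros eps (Heps & Hr & Hs & HKs' & HAl & HAB & Hmain) x Hx Hdet.
(* Arguing by contradiction provides [det0 <= A * eps], the nearness to a fold on which the lower
   bound of [shift] rests. *)
apply Rnot_le_lt; intros Hle.
enough (A * eps < det0 sigma lambda (K x)) by lra.
apply (Hmain (K x) (shift x)); [|apply Hr, Hx|assumption].
specialize (Hs x Hx); specialize (HKs' x Hx); simpl in Hs, HKs'.
pose proof (Rle_abs (shift x)); split; [|lra].
set (e := 5 * c ^ 2 * fst x ^ 2 / (12 * omega ^ 2)).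
assert (He : 0 <= e).
{ unfold e; apply Rmult_le_pos; [pose proof (pow2_ge_0 c); pose proof (pow2_ge_0 (fst x)); nra|].
  left; apply Rinv_0_lt_compat; pose proof (pow_lt _ 2 homega); lra. }
pose proof (fold_shift_lower_bound sigma lambda (K x) e He) as Hlow.
replace ((sigma - K x) * (3 * K x - sigma)) with (lambda ^ 2 / 4 - det0 sigma lambda (K x)) in Hlow
  by (unfold det0; ring).
specialize (Hlow ltac:(lra)).
assert (HK2 : km ^ 2 <= K x ^ 2).
{ rewrite <- (pow2_abs (K x)); apply pow_incr; split; [lra|].
  replace (K x) with (kappa * fst x ^ 2) by (unfold K, kappa; field; nonzero).
  rewrite Rabs_mult; unfold km, Rdiv; apply Rmult_le_compat_l; [apply Rabs_pos|].
  rewrite <- RPow_abs, <- pow_inv; apply pow_incr; split.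
  - left; apply Rinv_0_lt_compat; lra.
  - apply Hx. }
(* The definition of [det0] is used to eliminate [lambda ^ 2] from [shift]. *)
replace (shift x) with (/ omega *
  (K x * (2 * (sigma - K x) * (3 * K x * sigma - sigma ^ 2 / 2 - K x ^ 2 / 12 + e))
   + 2 * det0 sigma lambda (K x) * (K x * sigma)))
  by (unfold shift, e, det0; field; nonzero).
unfold Rdiv at 1; rewrite Rmult_comm.
apply Rmult_le_compat_l; [left; apply Rinv_0_lt_compat; lra|].
apply Rabs_le_between in HKs'.
assert (Hdk : - (A * eps * B) <= det0 sigma lambda (K x) * (K x * sigma)) by nra.
pose proof (pow2_ge_0 lambda); unfold h in *; nra.
Qed.

Lemma stationary_stable :
  at_right 0 (fun eps => forall x, pts eps x ->
    0 <= 9 * d ^ 2 * fst x ^ 4 / (16 * omega ^ 2) - lambda ^ 2 ->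
    sigma <= 3 * d * fst x ^ 2 / (4 * omega)
             - 1 / 2 * sqrt (9 * d ^ 2 * fst x ^ 4 / (16 * omega ^ 2) - lambda ^ 2) ->
    lyapunov_stable (f eps) (g eps) (fst x) (snd x)).
Proof.
destruct (Req_dec d 0) as [Hd|Hd].
(* For [d = 0] the quantity under the square root is [- lambda ^ 2 < 0], against the hypothesis. *)
{ apply filter_forall; intros eps x _ H0; exfalso; revert H0; rewrite Hd.
  replace (9 * 0 ^ 2 * fst x ^ 4 / (16 * omega ^ 2)) with 0 by (field; nonzero).
  pose proof (pow_lt _ 2 hlambda); lra. }
(* This [A] bounds the error in the scaled determinant, so [det0 > A * eps] makes the true
   determinant positive. *)
destruct det_leading as (A & HA & Hdet).
generalize (filter_and _ _ at_right_pos (filter_and _ _ Hdet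
  (filter_and _ _ (det0_large A Hd HA) (filter_and _ _ trace_negative
  (filter_and _ _ amplitude_differentiable phase_differentiable))))).
apply filter_imp; intros eps (Heps & HD & Hlarge & Htr & Hf & Hg) x Hx H0 Hs.
pose proof (pts_in_box _ _ Hx) as Hbox.
replace (9 * d ^ 2 * fst x ^ 4 / (16 * omega ^ 2)) with (4 * K x ^ 2) in *
  by (unfold K; field; nonzero).
replace (3 * d * fst x ^ 2 / (4 * omega)) with (2 * K x) in * by (unfold K; field; nonzero).
specialize (Hlarge x Hx (det0_nonneg _ _ _ H0 Hs)); specialize (HD x Hx).
apply Rabs_le_between in HD; rewrite pow_1 in HD.
apply linear_stability with (jac_aa eps x) (jac_ab eps x) (jac_ba eps x) (jac_bb eps x); auto.
- apply Hx.
- apply Hx.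
- set (D := jac_aa eps x * jac_bb eps x - jac_ab eps x * jac_ba eps x) in *.
  assert (H : 0 < D / eps ^ 2) by lra.
  apply Rlt_div_r in H; [lra|apply pow_lt; assumption].
Qed.


(** * Residual and periodicity of the approximate solution *)

Let frq (eps : R) : R := forced_frequency omega sigma eps.
Let uapp (eps a b : R) : R -> R :=
  approximation omega c d sigma eps (fun _ => a) (fun _ => b).

Definition corr (a th : R) : R :=
  - (c * a ^ 2 / (2 * omega ^ 2)) + c * a ^ 2 / (6 * omega ^ 2) * cos (2 * th)
  + d * a ^ 3 / (32 * omega ^ 2) * cos (3 * th).
Definition corr' (a th : R) : R :=
  - (c * a ^ 2 / (3 * omega ^ 2) * sin (2 * th)) - 3 * d * a ^ 3 / (32 * omega ^ 2) * sin (3 * th).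
Definition corr'' (a th : R) : R :=
  - (2 * c * a ^ 2 / (3 * omega ^ 2) * cos (2 * th)) - 9 * d * a ^ 3 / (32 * omega ^ 2) * cos (3 * th).

Lemma is_derive_uapp eps a b t : is_derive (uapp eps a b) t
  (frq eps * (- (eps * a * sin (frq eps * t + b)) + eps ^ 2 * corr' a (frq eps * t + b))).
Proof.
unfold uapp, approximation; fold (frq eps); unfold corr'.
auto_derive; [trivial|field; lra].
Qed.

Lemma is_derive2_uapp eps a b t : is_derive (Derive (uapp eps a b)) t
  (frq eps ^ 2 * (- (eps * a * cos (frq eps * t + b)) + eps ^ 2 * corr'' a (frq eps * t + b))).
Proof.
apply is_derive_ext with (fun t =>
  frq eps * (- (eps * a * sin (frq eps * t + b)) + eps ^ 2 * corr' a (frq eps * t + b))).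
{ intros s; symmetry; apply is_derive_unique, is_derive_uapp. }
unfold corr', corr''; auto_derive; [trivial|field; lra].
Qed.

Lemma cos_3 (th : R) : cos (3 * th) = 4 * cos th ^ 3 - 3 * cos th.
Proof.
replace (3 * th) with (2 * th + th) by ring.
rewrite cos_plus, sin_2a, cos_2a_cos.
pose proof (sin2_cos2 th) as H; unfold Rsqr in H.
replace (2 * sin th * cos th * sin th) with (2 * cos th * (sin th * sin th)) by ring.
replace (sin th * sin th) with (1 - cos th * cos th) by lra; ring.
Qed.

(** At order [eps ^ 2], [omega ^ 2 * (corr'' + corr)] cancels the quadratic term and the third
    harmonic of the cubic one. The remaining resonant sine and cosine have coefficients proportional
    to [amp1] and [phase1], hence [O(eps)]. *)
Lemma residual_bigO : bigO (fun eps (y : R * R * R) => pts eps (fst y)) 3 (fun eps y =>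
  let u := uapp eps (fst (fst y)) (snd (fst y)) in let t := snd y in
  Derive (Derive u) t + omega ^ 2 * u t + eps * lambda * Derive u t
  + c * u t ^ 2 + d / eps * u t ^ 3 - eps ^ 2 * Fm * cos (frq eps * t)).
Proof.
set (Q := fun eps (y : R * R * R) => pts eps (fst y)).
pose (A := fun y : R * R * R => fst (fst y)).
pose (th := fun eps (y : R * R * R) => frq eps * snd y + snd (fst y)).
apply bigO_ext with (fun eps y =>
  eps ^ 2 * (cos (th eps y) * (2 * A y * omega) * phase1 (fst (fst y)) (snd (fst y))
             + sin (th eps y) * (2 * omega) * amp1 (fst (fst y)) (snd (fst y)))
  + eps ^ 3 * (- (sigma ^ 2 * A y * cos (th eps y))
    + (2 * omega * sigma + eps * sigma ^ 2) * corr'' (A y) (th eps y)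
    + lambda * (- (sigma * A y * sin (th eps y)) + (omega + eps * sigma) * corr' (A y) (th eps y))
    + 2 * c * A y * cos (th eps y) * corr (A y) (th eps y)
    + eps * c * corr (A y) (th eps y) ^ 2
    + d * (3 * A y ^ 2 * cos (th eps y) ^ 2 * corr (A y) (th eps y)
           + 3 * eps * A y * cos (th eps y) * corr (A y) (th eps y) ^ 2
           + eps ^ 2 * corr (A y) (th eps y) ^ 3))).
{ intros eps [x t] Heps Hx; cbv zeta.
  rewrite (is_derive_unique _ _ _ (is_derive2_uapp _ _ _ _)),
    (is_derive_unique _ _ _ (is_derive_uapp _ _ _ _)).
  unfold A, th; simpl fst; simpl snd.
  change (uapp eps (fst x) (snd x) t) with
    (eps * fst x * cos (frq eps * t + snd x) + eps ^ 2 * corr (fst x) (frq eps * t + snd x)).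
  pose proof (pts_nonzero _ _ Hx) as Ha; simpl fst in Ha.
  set (p := frq eps * t + snd x).
  rewrite (Rmult_assoc (eps ^ 2) Fm).
  (* The forcing is rewritten relative to the phase [p] of the response, so that it can be compared
     with the resonant terms. *)
  replace (Fm * cos (frq eps * t)) with (cos p * (Fm * cos (snd x)) + sin p * (Fm * sin (snd x))).
  2:{ replace (frq eps * t) with (p - snd x) by (unfold p; ring); rewrite cos_minus; ring. }
  rewrite (cos_stationary x Ha), (sin_stationary x).
  unfold corr, corr', corr'', K; rewrite cos_3, cos_2a_cos.
  change (frq eps) with (omega + eps * sigma).
  field; nonzero. }
assert (HA : bigO Q 0 (fun _ y => A y)) by exact (bigO_comp pts Q 0 _ fst (fun _ _ H => H) bigO_a).
assert (He : bigO Q 0 (fun eps _ => eps)).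
{ apply bigO_weaken, bigO_ext with (fun eps _ => eps ^ 1); [intros; ring|apply bigO_eps]. }
assert (Hc : bigO Q 0 (fun eps y => corr (A y) (th eps y))) by (unfold corr; bounded HA He).
assert (Hc' : bigO Q 0 (fun eps y => corr' (A y) (th eps y))) by (unfold corr'; bounded HA He).
assert (Hc'' : bigO Q 0 (fun eps y => corr'' (A y) (th eps y))) by (unfold corr''; bounded HA He).
apply bigO_plus.
- apply (bigO_mult Q 2 1); [apply bigO_eps|].
  apply bigO_plus; apply bigO_mult0l.
  + bounded HA He.
  + exact (bigO_comp pts Q 1 _ fst (fun _ _ H => H) bigO_phase1).
  + bounded HA He.
  + exact (bigO_comp pts Q 1 _ fst (fun _ _ H => H) bigO_amp1).
- apply bigO_mult0r; [apply bigO_eps|].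
  repeat first [ apply Hc | apply Hc' | apply Hc'' | progress (bounded HA He) ].
Qed.

Lemma approximate_solution : exists C, at_right 0 (fun eps => forall x, pts eps x ->
  solves_forced_up_to omega lambda c d Fm sigma eps (C * eps ^ 3) (uapp eps (fst x) (snd x)) /\
  periodic (2 * PI / frq eps) (uapp eps (fst x) (snd x))).
Proof.
destruct residual_bigO as (C & _ & H); exists C.
(* The second condition, [- sigma * eps < omega], keeps the frequency positive. *)
generalize (filter_and _ _ H (at_right_linear (- sigma) omega homega)).
apply filter_imp; intros eps [Hr Hw] x Hx; split.
- intros t; repeat split.
  + eexists; apply is_derive_uapp.
  + eexists; apply is_derive2_uapp.
  + exact (Hr (x, t) Hx).
- assert (0 < frq eps) by (unfold frq, forced_frequency; lra).
  split; [apply Rdiv_lt_0_compat; [pose proof PI_RGT_0|]; lra|].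
  intros t; unfold uapp, approximation; fold (frq eps).
  (* The shift is put in the form [2 * INR k * PI] of [cos_period], with [k] equal to [1], [2] and
     [3] for the three harmonics. *)
  replace (frq eps * (t + 2 * PI / frq eps) + snd x)
    with (frq eps * t + snd x + 2 * INR 1 * PI) by (simpl; field; lra).
  set (th := frq eps * t + snd x).
  replace (2 * (th + 2 * INR 1 * PI)) with (2 * th + 2 * INR 2 * PI) by (simpl; ring).
  replace (3 * (th + 2 * INR 1 * PI)) with (3 * th + 2 * INR 3 * PI) by (simpl; ring).
  rewrite !cos_period; reflexivity.
Qed.

End AmplitudePhase.

Theorem proposition2p2 (omega lambda c d Fm sigma : R)
    (r1 r2 : R -> R -> R -> R)
    (homega : 0 < omega) (hlambda : 0 < lambda)
    (hr1 : third_order r1) (hr2 : third_order r2) :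
  forall M : R, 0 < M ->
  exists eps0 C : R, 0 < eps0 /\
  forall eps : R, 0 < eps < eps0 ->
  forall abar bbar : R, in_box M abar bbar ->
  let f := amplitude_rhs omega lambda d Fm sigma r1 eps in
  let g := phase_rhs omega lambda c d Fm sigma r2 eps in
  stationary f g abar bbar ->
  (0 <= 9 * d ^ 2 * abar ^ 4 / (16 * omega ^ 2) - lambda ^ 2 ->
   sigma <= 3 * d * abar ^ 2 / (4 * omega)
            - 1 / 2 * sqrt (9 * d ^ 2 * abar ^ 4 / (16 * omega ^ 2) - lambda ^ 2) ->
   lyapunov_stable f g abar bbar) /\
  (let w := forced_frequency omega sigma eps in
   let uapp := approximation omega c d sigma eps (fun _ => abar) (fun _ => bbar) in
   (forall t : R,
      uapp t =
      eps * abar * cos (w * t + bbar)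
      + eps ^ 2 * (- (c * abar ^ 2 / (2 * omega ^ 2))
                   + c * abar ^ 2 / (6 * omega ^ 2) * cos (2 * (w * t + bbar))
                   + d * abar ^ 3 / (32 * omega ^ 2) * cos (3 * (w * t + bbar)))) /\
   solves_forced_up_to omega lambda c d Fm sigma eps (C * eps ^ 3) uapp /\
   periodic (2 * PI / w) uapp).
Proof.
intros M hM.
pose proof (stationary_stable omega lambda c d Fm sigma r1 r2 M homega hlambda hr1 hr2 hM) as Hst.
destruct (approximate_solution omega lambda c d Fm sigma r1 r2 M homega hr1 hr2 hM) as [C Happ].
destruct (proj1 (at_right_interval _) (filter_and _ _ Hst Happ)) as (eps0 & Heps0 & H).
exists eps0, C; split; [assumption|].
intros eps Heps a b Hbox f g Hs; destruct (H eps Heps) as [H1 H2].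
split; [exact (H1 (a, b) (conj Hbox Hs))|].
intros w uapp; split; [reflexivity|exact (H2 (a, b) (conj Hbox Hs))].
Qed.
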